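(* Let $M=(E,G)$ be a full-rank matroid. Then $M$ is $I_4$-free and triangle-free if and only if at least one of the following holds: (i) $M$ can be obtained (up to isomorphism) from a $1$-dimensional matroid by a (possibly empty) sequence of $0$-expansions and $1$-expansions; or (ii) $M$ can be obtained (up to isomorphism) by a (possibly empty) sequence of doublings starting from $\mathrm{AG}^{\star}(n-1,2)$ for some $n\ge 3$.
   Context: A matroid here means a simple binary matroid with an ambient space: a pair $M=(E,G)$, where $G=\mathrm{PG}(n-1,2)$ is identified with $\mathbb F_2^n\setminus\{0\}$ ($n\ge 1$) and $E\subseteq G$ is arbitrary. The dimension of $M$ is $n$. $M$ is full-rank if $E$ spans $G$. $(E_1,G_1)$ and $(E_2,G_2)$ are isomorphic if some linear isomorphism maps $G_1$ to $G_2$ and $E_1$ to $E_2$. A flat (subgeometry) of $G$ is a set $F\subseteq G$ with $F\cup\{0\}$ a linear subspace (the empty set is the flat of dimension $0$); a hyperplane is a maximal proper flat; a triangle is a $2$-dimensional flat, i.e. $\{x,y,x+y\}$ with $x\ne y$ in $G$. For a flat $F$, $M|F=(E\cap F,F)$. $M$ is $I_4$-free if there is no $4$-dimensional flat $F$ of $G$ such that $E\cap F$ is a basis of $F$. $M$ is triangle-free if $E$ contains no triangle of $G$. $M$ is affine if there is a hyperplane $H$ of $G$ with $E\subseteq G\setminus H$. Expansions: let $M=(E,G)$ be affine, with hyperplane $H$ of $G$ such that $E\subseteq G\setminus H$. $M'=(E',G')$ is a $0$-expansion of $M$ if $G$ is a hyperplane of $G'$ and $E'=E$. $M'=(E',G')$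 is a $1$-expansion of $M$ if $G$ is a hyperplane of $G'$ and there is $x\in G'\setminus G$ with $E'=E\cup(x+H)\cup\{x\}$. (Both kinds of expansion of an affine matroid are again affine.) Doublings: $M=(E,G)$ is a doubling of a matroid $M_0$ if there are $w\in G\setminus E$ and a hyperplane $H$ of $G$ not containing $w$ with $M|H\cong M_0$ and $E=(E\cap H)\cup(w+(E\cap H))$. $\mathrm{AG}^{\star}(n-1,2)$ denotes (up to isomorphism) the $(n+1)$-dimensional matroid $(E,G)$ for which there are flats $H_0\subset G_0\subset G$, with $G_0$ a hyperplane of $G$ and $H_0$ a hyperplane of $G_0$, and elements $x\in G\setminus G_0$, $y\in G_0\setminus H_0$ such that $E=(G_0\setminus H_0)\,\triangle\,\{x,y,x+y\}$ (symmetric difference). *)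

(* Defs.v *)
From mathcomp Require Import all_boot all_algebra.

Set Implicit Arguments.
Unset Strict Implicit.
Unset Printing Implicit Defensive.

Import GRing.Theory.
Local Open Scope ring_scope.

(** A flat [F] of a binary projective geometry is represented by the linear
    subspace [F] together with [0], so the dimension of the flat is [\dim F] and
    the empty flat is [0%VS]; [points F] is the flat as a set. *)
Definition points N (F : {vspace 'rV['F_2]_N}) : {set 'rV['F_2]_N} :=
  [set x | (x \in F) && (x != 0)].

(** A pair (E, G), where [G] may be any flat of the ambient PG(N-1, 2): matroids
    on nested flats ([M|F], or [G] a hyperplane of [G']) then live in one space.
    The case G = PG(N-1, 2) is [geom M = fullv]. *)
Record matroid (N : nat) := Matroid {
  geom : {vspace 'rV['F_2]_N};
  elts : {set 'rV['F_2]_N};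
  elts_sub : elts \subset points geom
}.

Definition mdim N (M : matroid N) : nat := \dim (geom M).

Definition full_rank N (M : matroid N) : Prop :=
  <<enum (elts M)>>%VS = geom M.

Definition isomorphic N1 N2 (M1 : matroid N1) (M2 : matroid N2) : Prop :=
  exists f : 'Hom('rV['F_2]_N1, 'rV['F_2]_N2),
    [/\ {in geom M1 &, injective f},
        (f @: geom M1)%VS = geom M2
      & [set f x | x in elts M1] = elts M2].

Definition hyperplane N (H G : {vspace 'rV['F_2]_N}) : Prop :=
  [/\ (H <= G)%VS, H != G &
      forall F : {vspace 'rV['F_2]_N},
        (H <= F)%VS -> (F <= G)%VS -> F != G -> F = H].

Lemma restrict_sub N (M : matroid N) (F : {vspace 'rV['F_2]_N}) :
  elts M :&: points F \subset points F.
Proof. exact: subsetIr. Qed.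

Definition restrict N (M : matroid N) (F : {vspace 'rV['F_2]_N}) : matroid N :=
  Matroid (restrict_sub M F).

Definition I4_free N (M : matroid N) : Prop :=
  ~ exists F : {vspace 'rV['F_2]_N},
      [/\ (F <= geom M)%VS, \dim F = 4%N &
          basis_of F (enum (elts (restrict M F)))].

Definition triangle_free N (M : matroid N) : Prop :=
  ~ exists F : {vspace 'rV['F_2]_N},
      [/\ (F <= geom M)%VS, \dim F = 2%N & points F \subset elts M].

Definition affine_wrt N (M : matroid N) (H : {vspace 'rV['F_2]_N}) : Prop :=
  hyperplane H (geom M) /\ elts M \subset points (geom M) :\: points H.

Definition affine N (M : matroid N) : Prop := exists H, affine_wrt M H.

Definition is_0_expansion N (M M' : matroid N) : Prop :=
  [/\ affine M, hyperplane (geom M) (geom M') & elts M' = elts M].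

(** [points H] omits [0], hence the separate [[set x]]. *)
Definition is_1_expansion N (M M' : matroid N) : Prop :=
  exists H : {vspace 'rV['F_2]_N},
    [/\ affine_wrt M H, hyperplane (geom M) (geom M') &
        exists2 x, x \in points (geom M') :\: points (geom M) &
          elts M' = elts M :|: [set x + h | h in points H] :|: [set x]].

Inductive obtained_by_expansions : forall N, matroid N -> Prop :=
| Expansions_start N (M : matroid N) :
    mdim M = 1%N -> obtained_by_expansions M
| Expansions_0 N (M M' : matroid N) :
    obtained_by_expansions M -> is_0_expansion M M' ->
    obtained_by_expansions M'
| Expansions_1 N (M M' : matroid N) :
    obtained_by_expansions M -> is_1_expansion M M' ->
    obtained_by_expansions M'
| Expansions_iso N1 N2 (M1 : matroid N1) (M2 : matroid N2) :
    obtained_by_expansions M1 -> isomorphic M1 M2 ->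
    obtained_by_expansions M2.

Definition is_doubling N0 N (M0 : matroid N0) (M : matroid N) : Prop :=
  exists (w : 'rV['F_2]_N) (H : {vspace 'rV['F_2]_N}),
    [/\ w \in points (geom M) :\: elts M,
        hyperplane H (geom M), w \notin points H,
        isomorphic (restrict M H) M0 &
        elts M = (elts M :&: points H)
                   :|: [set w + z | z in elts M :&: points H]].

Definition symdiff (T : finType) (A B : {set T}) : {set T} :=
  (A :\: B) :|: (B :\: A).

(** [is_AGstar n M]: [M] is a copy of AG*(n-1, 2). *)
Definition is_AGstar (n N : nat) (M : matroid N) : Prop :=
  mdim M = n.+1 /\
  exists (H0 G0 : {vspace 'rV['F_2]_N}) (x y : 'rV['F_2]_N),
    [/\ hyperplane G0 (geom M), hyperplane H0 G0,
        x \in points (geom M) :\: points G0, y \in points G0 :\: points H0 &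
        elts M = symdiff (points G0 :\: points H0) [set x; y; x + y]].

Inductive obtained_by_doublings : forall N, matroid N -> Prop :=
| Doublings_start n N (M : matroid N) :
    (3 <= n)%N -> is_AGstar n M -> obtained_by_doublings M
| Doublings_step N0 N (M0 : matroid N0) (M : matroid N) :
    obtained_by_doublings M0 -> is_doubling M0 M -> obtained_by_doublings M
| Doublings_iso N1 N2 (M1 : matroid N1) (M2 : matroid N2) :
    obtained_by_doublings M1 -> isomorphic M1 M2 ->
    obtained_by_doublings M2.

(* Main.v *)
(** Call E sum-free if a + b never lies in E for a, b in E. A sum-free E is
    I_4-free iff for all a, b, c, d in E one of the four triple sums or the sum
    a + b + c + d lies in E. This condition is a universal statement about sums,
    so it passes through the linear maps behind isomorphisms and doublings.

    Suppose E is affine, inside the complement of H. Every coset of H off H then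
    contains a monochromatic translate of a hyperplane of H: by induction there is
    one of codimension 2, say S disjoint from E, and three parallel cosets S_i. If
    B_i is the trace of E on S_i and T_i its stabiliser, the condition on the
    3-dimensional flats that meet S and every S_i gives B_1 + B_1 <= T_2 u T_3 (and
    cyclically), so that two of the S_i lie in E, or the largest T_i is proper in the
    common direction space and each B_i lies in one of its cosets, and then some
    hyperplane avoids all the traces. A monochromatic hyperplane exhibits E as an expansion.

    If E is not affine, a shortest odd zero-sum list in E has length 5: a pentagon.
    For v in E, the trace of E on the coset of v modulo the span of the pentagon is
    either a translate of the pentagon, whose centre is then a period of E (a
    doubling), or {v, v+ci+cj, v+ci+ck, v+cj+ck} for some i, j, k. If E has no
    period, {i, j, k} is the same for all v off the pentagon, and with y the sum of the other two
    members of the pentagon, E minus these two members, plus y, is a translate of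
    a subspace: E is AG*. The finitely many configurations involved live in
    dimension at most 6 and are settled by a verified search. *)

From Stdlib Require Import BinNat.
Require Import Defs.
From mathcomp Require Import all_boot all_algebra.

Set Implicit Arguments.
Unset Strict Implicit.
Unset Printing Implicit Defensive.

Import GRing.Theory.
Local Open Scope ring_scope.

(** * Linear algebra over F_2 *)

Lemma F2_cases (k : 'F_2) : k = 0 \/ k = 1.
Proof. by case: k => [[|[|//]] hk]; [left | right]; apply/val_inj. Qed.

Section Char2.
Variable N : nat.
Local Notation V := 'rV['F_2]_N.
Implicit Types (x y z v w : V) (U W G H : {vspace V}) (s : seq V).

Lemma addxx x : x + x = 0.
Proof. by apply/rowP => i; rewrite !mxE; case: (F2_cases (x 0 i)) => ->; apply/val_inj. Qed.

Lemma addxKx x y : x + (x + y) = y.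
Proof. by rewrite addrA addxx add0r. Qed.

Lemma oppx x : - x = x.
Proof. by apply/eqP; rewrite eq_sym -subr_eq0 opprK addxx. Qed.

Lemma addx_eq0 x y : (x + y == 0) = (x == y).
Proof. by rewrite -[X in x + X]oppx subr_eq0. Qed.

Lemma addx_eqr x y : (x + y == y) = (x == 0).
Proof. by rewrite -[LHS]addx_eq0 -addrA addxx addr0. Qed.

Lemma mem_adjoin U x v : (v \in (U + <[x]>)%VS) = (v \in U) || (v + x \in U).
Proof.
apply/idP/idP => [/memv_addP[u uU [k /vlineP[l ->] ->]]|].
  case: (F2_cases l) => ->; first by rewrite scale0r addr0 uU.
  by rewrite scale1r -addrA addxx addr0 uU orbT.
case/orP => [vU|vU]; first by rewrite -[v]addr0 memv_add ?mem0v.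
by rewrite -[v]addr0 -(addxx x) addrA memv_add ?memv_line.
Qed.

Lemma mem_span_cons x s v :
  (v \in <<x :: s>>%VS) = (v \in <<s>>%VS) || (v + x \in <<s>>%VS).
Proof. by rewrite span_cons addvC mem_adjoin. Qed.

Lemma mem_span_nil v : (v \in <<[::]>>%VS) = (v == 0).
Proof. by rewrite span_nil memv0. Qed.

Lemma mem_span_sum s v : v \in <<s>>%VS ->
  exists2 t, {subset t <= s} & v = \sum_(x <- t) x.
Proof.
elim: s v => [|x s IHs] v.
  by rewrite mem_span_nil => /eqP->; exists [::]; rewrite ?big_nil.
rewrite mem_span_cons => /orP[] /IHs[t ts def_v].
  by exists t => // z /ts zs; rewrite inE zs orbT.
exists (x :: t).
  by move=> z; rewrite !inE => /orP[->//|/ts->]; rewrite orbT.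
by rewrite big_cons -def_v addrCA addxx addr0.
Qed.

Lemma closed_vspace (A : {set V}) : 0 \in A ->
  {in A &, forall x y, x + y \in A} -> exists U, U =i A.
Proof.
move=> A0 AD; exists <<enum A>>%VS => v; apply/idP/idP => [|vA].
  case/mem_span_sum => t tA ->; rewrite big_seq; elim/big_rec: _ => // x y xt.
  by apply: AD; have := tA _ xt; rewrite mem_enum.
by apply: memv_span; rewrite mem_enum.
Qed.

Lemma dimv_add_line_le U x : (\dim (U + <[x]>) <= (\dim U).+1)%N.
Proof.
apply: leq_trans (leq_of_leqif (dimv_add_leqif _ _)) _.
by rewrite dim_vline; case: (x != 0); rewrite ?addn1 ?addn0.
Qed.

Lemma dimv_add_line U x : x \notin U -> \dim (U + <[x]>) = (\dim U).+1.
Proof.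
move=> xU; apply/eqP; rewrite eqn_leq dimv_add_line_le /=.
have xn0 : x != 0 by apply: contraNneq xU => ->; apply: mem0v.
rewrite dimv_disjoint_sum ?dim_vline ?xn0 ?addn1 //.
apply/eqP; rewrite -subv0; apply/subvP => z /memv_capP[zU /vlineP[k def_z]].
move: zU; rewrite {}def_z; case: (F2_cases k) => ->; rewrite ?scale0r ?mem0v //.
by rewrite scale1r (negPf xU).
Qed.

Lemma proper_dimv U W : (U <= W)%VS -> U != W -> (\dim U < \dim W)%N.
Proof.
move=> UW; apply: contra_neqT; rewrite -leqNgt => dWU.
by apply/eqP; rewrite eqEdim UW.
Qed.

Lemma notin_vspace U W : (U <= W)%VS -> U != W -> exists2 x, x \in W & x \notin U.
Proof.
move=> UW UneW; apply/subvPn; apply: contraNN UneW => WU.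
by apply/eqP/subv_anti; rewrite UW.
Qed.

Lemma hyperplane_dim H G : hyperplane H G -> (H <= G)%VS /\ \dim G = (\dim H).+1.
Proof.
case=> HG HneG maxH; split=> //; have [x xG xH] := notin_vspace HG HneG.
have xHG : (H + <[x]> <= G)%VS by rewrite subv_add HG -memvE.
have [<-|ne] := eqVneq (H + <[x]>)%VS G; first exact: dimv_add_line.
have eqH := maxH _ (addvSl _ _) xHG ne.
by case/negP: xH; rewrite -eqH mem_adjoin addxx mem0v orbT.
Qed.

Lemma dim_hyperplane H G : (H <= G)%VS -> \dim G = (\dim H).+1 -> hyperplane H G.
Proof.
move=> HG dG; split=> //.
  by apply/eqP => eHG; move: dG; rewrite -eHG => /eqP; rewrite eqn_leq ltnn andbF.
move=> F HF FG FneG; apply/eqP; rewrite eq_sym eqEdim HF -ltnS -dG.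
exact: proper_dimv.
Qed.

Lemma hyperplane_adjoin H G x : hyperplane H G -> x \in G -> x \notin H ->
  G = (H + <[x]>)%VS.
Proof.
case/hyperplane_dim => HG dG xG xH; apply/eqP.
by rewrite eq_sym eqEdim dimv_add_line // dG leqnn andbT subv_add HG -memvE.
Qed.

Lemma adjoin_hyperplane H x : x \notin H -> hyperplane H (H + <[x]>).
Proof. by move=> xH; apply: dim_hyperplane (addvSl _ _) (dimv_add_line xH). Qed.

Lemma hyperplane_memD H G x y : hyperplane H G -> x \in G -> y \in G ->
  x \notin H -> y \notin H -> x + y \in H.
Proof.
move=> hH xG yG xH yH; move: xG; rewrite (hyperplane_adjoin hH yG yH) mem_adjoin.
by rewrite (negPf xH).
Qed.

Lemma exists_hyperplane U G x : (U <= G)%VS -> x \in G -> x \notin U ->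
  exists H, [/\ (U <= H)%VS, x \notin H & hyperplane H G].
Proof.
(* [D] is a complement of [U + <[x]>] in [G], so [U + D] misses [x] and has codimension one. *)
move=> UG xG xU; pose D := (G :\: (U + <[x]>))%VS; pose H := (U + D)%VS.
have UxG : (U + <[x]> <= G)%VS by rewrite subv_add UG -memvE.
have HG : (H + <[x]>)%VS = G.
  by rewrite /H -addvA [(D + _)%VS]addvC addvA addvC addv_diff; apply/addv_idPl.
have xH : x \notin H.
  apply/negP => /memv_addP[u uU [d dD def_x]].
  have d_Ux : d \in (U + <[x]>)%VS.
    by rewrite mem_adjoin def_x addrCA addxx addr0 uU orbT.
  have /eqP d0 : d == 0 by rewrite -memv0 -(capv_diff G (U + <[x]>)) memv_cap dD.
  by move: xU; rewrite def_x d0 addr0 uU.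
by exists H; rewrite addvSl xH -HG; split=> //; apply: adjoin_hyperplane.
Qed.

End Char2.

(** Proves equalities of sums in characteristic 2: both sides are gathered into one sum, whose equal
    terms cancel in pairs. *)
Ltac f2_cancel := solve [
  apply/eqP; rewrite -addx_eq0; apply/eqP; rewrite -?addrA;
  match goal with |- ?a = 0 => rewrite -[a]addr0 end; rewrite -?addrA ?addr0 ?add0r;
  repeat first
    [ reflexivity | rewrite addxx | rewrite addxKx | rewrite add0r | rewrite addr0
    | match goal with |- ?x + _ = 0 =>
        first [rewrite [_ + (x + _)]addrCA | rewrite [_ + x]addrC] end ]].

(** * Sum-free sets without induced I_4 *)

(* With repetitions allowed among [a b c d], the I_4 condition needs no
   independence hypothesis: in a sum-free set a dependency among four elements
   makes one of the listed sums fall in the set. *)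
Definition sumfree N (E : {set 'rV['F_2]_N}) : Prop :=
  {in E &, forall a b, a + b \notin E}.

Definition quad_closed N (E : {set 'rV['F_2]_N}) : Prop :=
  forall a b c d, a \in E -> b \in E -> c \in E -> d \in E ->
  [|| a + b + c \in E, a + b + d \in E, a + c + d \in E, b + c + d \in E
    | a + b + c + d \in E].

Lemma sumfree0 N (E : {set 'rV['F_2]_N}) : sumfree E -> 0 \notin E.
Proof. by move=> sfE; apply/negP=> E0; have := sfE _ _ E0 E0; rewrite addr0 E0. Qed.

Section FreeConditions.
Variables (N : nat) (M : matroid N).
Local Notation E := (elts M).

Lemma elts_geom v : v \in E -> v \in geom M.
Proof. by move/(subsetP (elts_sub M)); rewrite inE => /andP[]. Qed.

Lemma elts_neq0 v : v \in E -> v != 0.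
Proof. by move/(subsetP (elts_sub M)); rewrite inE => /andP[]. Qed.

Lemma sumfree_triangle_free : sumfree E <-> triangle_free M.
Proof.
split=> [sfE [F [_ dF FE]] | tfE a b aE bE].
  have [a [b bX]] : exists a b, basis_of F [:: a; b].
    have := etrans (size_tuple (vbasis F)) dF; have := vbasisP F.
    by case: (tval (vbasis F)) => [|a [|b [|]]] // bX _; exists a, b.
  have [sX fX] := andP bX.
  have inF v : v \in F -> v != 0 -> v \in E.
    by move=> vF vn0; apply: (subsetP FE); rewrite inE vF.
  have memX v : v \in [:: a; b] -> v \in F by apply: basis_mem bX.
  move: fX; rewrite free_cons => /andP[aX fb].
  have [aF bF] : a \in F /\ b \in F by split; apply: memX; rewrite !inE eqxx ?orbT.
  move: aX; rewrite mem_span_cons !mem_span_nil negb_or => /andP[a0 ab0].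
  have b0 : b != 0 by move: fb; rewrite free_cons mem_span_nil => /andP[].
  have /negP[] := sfE _ _ (inF _ aF a0) (inF _ bF b0).
  by apply: inF => //; apply: rpredD.
apply/negP => abE; apply: tfE; exists <<[:: a; b]>>%VS.
have n0 := elts_neq0.
split; first by apply/span_subvP => v; rewrite !inE => /orP[]/eqP->; apply: elts_geom.
  apply/eqP; change (free [:: a; b]).
  by rewrite !free_cons nil_free mem_span_cons !mem_span_nil negb_or !n0.
apply/subsetP => v; rewrite inE !mem_span_cons !mem_span_nil !addx_eq0.
case/andP=> /orP[/orP[/eqP->|/eqP->//]|/orP[/eqP->//|/eqP def_b _]]; first by rewrite eqxx.
by move: abE; rewrite -def_b addrCA addxx addr0.
Qed.

(** The fifteen nonzero combinations of four independent vectors are the vectors themselves, the six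
    pair sums, which sum-freeness keeps out of [E], and the five sums of [quad_closed]. *)
Lemma quad_closed_I4_free : sumfree E -> quad_closed E <-> I4_free M.
Proof.
move=> sfE; split=> [qcE [F [_ dF bX]] | ifE a b c d aE bE cE dE].
  have memX v : (v \in enum (elts (restrict M F))) = (v \in E) && (v \in F).
    rewrite mem_enum /= !inE; apply: andb_id2l => vE.
    by rewrite (elts_neq0 vE) andbT.
  move: (enum _) bX memX => X bX memX.
  have [a [b [c [d defX]]]] : exists a b c d, X = [:: a; b; c; d].
    have sz : size X = 4%N.
      by have [/eqP sX /eqP <-] := andP bX; rewrite sX.
    case: X sz {bX memX} => [|a [|b [|c [|d [|]]]]] // _.
    by exists a, b, c, d.
  have [_ fX] := andP bX.
  have /allP : {subset X <= [pred v | (v \in E) && (v \in F)]} by move=> v; rewrite memX.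
  rewrite {1}defX /= !andbA andbT =>
    /andP[/andP[/andP[/andP[/andP[/andP[/andP[aE aF] bE] bF] cE] cF] dE] dF'].
  have inX v : v \in E -> v \in F -> [|| v == a, v == b, v == c | v == d].
    by move=> vE vF; have := memX v; rewrite vE vF defX !inE.
  move: fX; rewrite defX !free_cons nil_free !mem_span_cons !mem_span_nil.
  rewrite !negb_or !andbT -!andbA.
  (* Freeness unfolds into fifteen inequations; a listed sum equal to one of [a], [b], [c], [d]
     violates one of them. *)
  do 14 case/andP=> ?; move=> ?.
  have /or4P[|||/orP[]] := qcE a b c d aE bE cE dE; move/inX;
    rewrite ?rpredD // => /(_ isT); case/or4P; rewrite -addx_eq0 => /eqP z;
    match goal with H : is_true (_ != 0) |- _ =>
      by case/eqP: H; rewrite -z; f2_cancel end.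
apply: contraT; rewrite !negb_or; case/and5P=> n1 n2 n3 n4 n5.
have [ab ac ad bc bd] := And5 (sfE a b aE bE) (sfE a c aE cE) (sfE a d aE dE)
  (sfE b c bE cE) (sfE b d bE dE).
have cd := sfE c d cE dE.
have nz x y : x \notin E -> y \in E -> x + y != 0.
  by move=> xE yE; rewrite addx_eq0; apply: contraNneq xE => ->.
have nzab : a + b != 0 by apply: contraNneq n1 => ->; rewrite add0r.
have nzac : a + c != 0 by apply: contraNneq n3 => ->; rewrite add0r.
have nzad : a + d != 0 by apply: contraNneq n2; rewrite addrAC => ->; rewrite add0r.
have nzbc : b + c != 0 by apply: contraNneq n4 => ->; rewrite add0r.
have nzbd : b + d != 0 by apply: contraNneq n2; rewrite -addrA => ->; rewrite addr0.
have nzcd : c + d != 0 by apply: contraNneq n3; rewrite -addrA => ->; rewrite addr0.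
have [nza nzb nzc nzd] := And4 (elts_neq0 aE) (elts_neq0 bE) (elts_neq0 cE) (elts_neq0 dE).
have [nzabc nzabd nzacd nzbcd nzabcd] :=
  And5 (nz _ _ ab cE) (nz _ _ ab dE) (nz _ _ ac dE) (nz _ _ bc dE) (nz _ _ n1 dE).
have fX : free [:: a; b; c; d].
  rewrite !free_cons nil_free !mem_span_cons !mem_span_nil !negb_or.
  by repeat match goal with |- is_true (_ && _) => apply/andP; split end.
case: ifE; exists <<[:: a; b; c; d]>>%VS; split.
- by apply/span_subvP => v; rewrite !inE => /or4P[]/eqP->; apply: elts_geom.
- by have /eqP := fX.
rewrite (perm_basis (Y := [:: a; b; c; d])); first by rewrite /basis_of eqxx.
apply: uniq_perm; rewrite ?enum_uniq ?free_uniq // => v.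
rewrite mem_enum !inE; apply/idP/idP => [/and3P[vE]|].
  rewrite !mem_span_cons !mem_span_nil => vX vn0.
  move: vX; rewrite (negPf vn0) -!addrA !addx_eq0 -!orbA /=.
  do ![case/orP]; move/eqP=> def_v; rewrite def_v ?eqxx ?orbT //;
    by move: vE; rewrite def_v ?addrA ?(negPf ab, negPf ac, negPf ad, negPf bc,
      negPf bd, negPf cd, negPf n1, negPf n2, negPf n3, negPf n4, negPf n5).
by case/or4P=> /eqP->; rewrite elts_neq0 ?memv_span ?inE ?eqxx ?orbT ?andbT.
Qed.

End FreeConditions.

Definition good N (E : {set 'rV['F_2]_N}) : Prop := sumfree E /\ quad_closed E.

Lemma goodP N (M : matroid N) : good (elts M) <-> I4_free M /\ triangle_free M.
Proof.
rewrite /good; have := sumfree_triangle_free M; have := @quad_closed_I4_free _ M.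
tauto.
Qed.

(** * Closure under the constructions *)

Lemma quad_closed_eq N (E : {set 'rV['F_2]_N}) a b c d :
  c \in E -> a = b ->
  [|| a + b + c \in E, a + b + d \in E, a + c + d \in E, b + c + d \in E
    | a + b + c + d \in E].
Proof. by move=> cE ->; rewrite addxx add0r cE. Qed.

Lemma good_dim1 N (M : matroid N) : mdim M = 1%N -> good (elts M).
Proof.
move=> dM; have h0 : hyperplane 0%VS (geom M).
  by apply: dim_hyperplane; rewrite ?sub0v // dimv0.
have eqE a b : a \in elts M -> b \in elts M -> a = b.
  move=> aE bE; apply/eqP; rewrite -addx_eq0 -memv0.
  by apply: hyperplane_memD h0 _ _ _ _; rewrite ?memv0 ?(elts_neq0 (M := M)) ?elts_geom.
split=> [a b aE bE | a b c d aE bE cE dE]; last by apply: quad_closed_eq => //; apply: eqE.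
rewrite (eqE a b) // addxx; apply/negP => /(elts_neq0 (M := M)).
by rewrite eqxx.
Qed.

Lemma mem_translate N (H : {vspace 'rV['F_2]_N}) x v :
  (v \in [set x + h | h in points H] :|: [set x]) = (v + x \in H).
Proof.
rewrite !inE; apply/orP/idP => [[/imsetP[h]|/eqP->]|vxH].
- by rewrite inE => /andP[hH _] ->; rewrite addrC addxKx.
- by rewrite addxx mem0v.
have [->|vx] := eqVneq v x; [by right | left].
apply/imsetP; exists (v + x); last by rewrite addrC -addrA addxx addr0.
by rewrite inE vxH addx_eq0.
Qed.

(** Two elements of [elts M] sum into [H], so a triple with an odd number of members in the coset
    [x + H] sums into that coset; every quadruple meeting the coset contains such a triple. *)
Lemma good_1_expansion N (M M' : matroid N) :
  good (elts M) -> is_1_expansion M M' -> good (elts M').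
Proof.
case=> sfE qcE [H [[hH EH] hG [x xG' defE']]].
move: xG'; rewrite !inE => /andP[xG /andP[xG' xn0]].
have {xG} xG : x \notin geom M by move: xG; rewrite xn0 andbT.
have [HG _] := hyperplane_dim hH.
have memE' v : (v \in elts M') = (v \in elts M) || (v + x \in H).
  by rewrite defE' -setUA inE mem_translate.
have Egeom v : v \in elts M -> (v \in geom M) /\ v \notin H.
  move=> vE; have := subsetP EH v vE; rewrite !inE => /andP[vH /andP[vG vn0]].
  by rewrite vn0 andbT in vH.
have geomE v : v + x \in H -> v \notin geom M.
  move=> vxH; apply: contra xG => vG.
  by rewrite -[x](addxKx v) rpredD // (subvP HG).
have EED a b : a \in elts M -> b \in elts M -> a + b \in H.
  by move=> /Egeom[aG aH] /Egeom[bG bH]; apply: hyperplane_memD hH _ _ _ _.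
have EDE a b : a \in elts M -> b + x \in H -> a + b \notin elts M'.
  move=> /Egeom[aG aH] bx; rewrite memE' negb_or; apply/andP; split.
    apply/negP => /Egeom[abG _]; have := geomE _ bx.
    by rewrite -[b](addxKx a) rpredD.
  by rewrite -addrA rpredDr.
split=> [a b|a b c d]; rewrite !memE'.
  case/orP=> [aE|ax]; case/orP=> [bE|bx].
  - rewrite negb_or sfE //=; apply/negP => /geomE/negP[].
    by have [aG _] := Egeom _ aE; have [bG _] := Egeom _ bE; rewrite rpredD.
  - by rewrite -memE' EDE.
  - by rewrite -memE' addrC EDE.
  - have abH : a + b \in H.
      by rewrite -[a + b](_ : (a + x) + (b + x) = _); [rewrite rpredD | f2_cancel].
    rewrite negb_or; apply/andP; split; first by apply/negP => /Egeom[_]; rewrite abH.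
    by apply: contra xG => abxH; rewrite (subvP HG) // -[x](addxKx (a + b)) rpredD.
have EEC u v w : u \in elts M -> v \in elts M -> w + x \in H -> u + v + w + x \in H.
  by move=> uE vE wx; rewrite -addrA rpredD // EED.
have CCC u v w : u + x \in H -> v + x \in H -> w + x \in H -> u + v + w + x \in H.
  move=> ux vx wx; rewrite (_ : _ + x = (u + x) + (v + x) + (w + x)); last by f2_cancel.
  by apply: rpredD => //; apply: rpredD.
have ECE u v w : u \in elts M -> v + x \in H -> w \in elts M -> u + v + w + x \in H.
  by move=> uE vx wE; rewrite [u + v + w]addrAC EEC.
have CEE u v w : u + x \in H -> v \in elts M -> w \in elts M -> u + v + w + x \in H.
  by move=> ux vE wE; rewrite [u + v]addrC ECE.
case/orP=> a_; case/orP=> b_; case/orP=> c_; case/orP=> d_.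
- by have /or4P[->|->|->|/orP[->|->]] := qcE _ _ _ _ a_ b_ c_ d_; rewrite ?orbT.
- by rewrite (EEC _ _ _ a_ b_ d_) !orbT.
- by rewrite (EEC _ _ _ a_ b_ c_) !orbT.
- by rewrite (EEC _ _ _ a_ b_ c_) !orbT.
- by rewrite (ECE _ _ _ a_ b_ c_) !orbT.
- by rewrite (ECE _ _ _ a_ b_ c_) !orbT.
- by rewrite (ECE _ _ _ a_ b_ d_) !orbT.
- by rewrite (CCC _ _ _ b_ c_ d_) !orbT.
- by rewrite (CEE _ _ _ a_ b_ c_) !orbT.
- by rewrite (CEE _ _ _ a_ b_ c_) !orbT.
- by rewrite (CEE _ _ _ a_ b_ d_) !orbT.
- by rewrite (CCC _ _ _ a_ c_ d_) !orbT.
- by rewrite (CEE _ _ _ a_ c_ d_) !orbT.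
- by rewrite (CCC _ _ _ a_ b_ d_) !orbT.
- by rewrite (CCC _ _ _ a_ b_ c_) !orbT.
- by rewrite (CCC _ _ _ a_ b_ c_) !orbT.
Qed.

Lemma good_isomorphic N1 N2 (M1 : matroid N1) (M2 : matroid N2) :
  good (elts M1) -> isomorphic M1 M2 -> good (elts M2).
Proof.
case=> sfE qcE [f [injf _ <-]].
have G := @elts_geom _ M1.
split=> [_ _ /imsetP[a aE ->] /imsetP[b bE ->]
  | _ _ _ _ /imsetP[a aE ->] /imsetP[b bE ->] /imsetP[c cE ->] /imsetP[d dE ->]].
  rewrite -linearD; apply/imsetP => -[c cE /injf fc]; have := sfE a b aE bE.
  by rewrite fc ?cE ?rpredD // G.
have := qcE a b c d aE bE cE dE; rewrite -!linearD.
by case/or4P=> [|||/orP[]] /(imset_f f) ->; rewrite ?orbT.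
Qed.

(** Serves isomorphisms read backwards and the projection along the period of a doubling. *)
Lemma good_preimage N1 N2 (G : {vspace 'rV['F_2]_N1}) (f : 'rV['F_2]_N1 -> 'rV['F_2]_N2)
    (E1 : {set 'rV['F_2]_N1}) (E2 : {set 'rV['F_2]_N2}) :
    {subset E1 <= G} -> {in G &, {morph f : x y / x + y}} ->
    {in G, forall x, (x \in E1) = (f x \in E2)} ->
  good E2 -> good E1.
Proof.
move=> E1G fD memE1 [sfE qcE].
have E1f x : x \in E1 -> f x \in E2 by move=> xE; rewrite -memE1 // E1G.
split=> [a b aE bE | a b c d aE bE cE dE].
  by rewrite memE1 ?rpredD ?E1G // fD ?E1G // sfE // E1f.
have := qcE _ _ _ _ (E1f _ aE) (E1f _ bE) (E1f _ cE) (E1f _ dE).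
by rewrite -!fD ?rpredD ?E1G // -!memE1 ?rpredD ?E1G.
Qed.

Lemma good_isomorphic_sym N1 N2 (M1 : matroid N1) (M2 : matroid N2) :
  good (elts M2) -> isomorphic M1 M2 -> good (elts M1).
Proof.
move=> gM2 [f [injf _ fE]]; apply: (good_preimage (G := geom M1) (f := f)) gM2.
- exact: elts_geom.
- by move=> x y _ _; apply: linearD.
move=> x xG; rewrite -fE; apply/idP/imsetP => [xE|[y yE]]; first by exists x.
by move/(injf _ _ xG (elts_geom yE))->.
Qed.

Lemma good_doubling N0 N (M0 : matroid N0) (M : matroid N) :
  good (elts M0) -> is_doubling M0 M -> good (elts M).
Proof.
move=> gM0 [w [H [wGE hH wH isoM0 defE]]].
have {wGE} [wG wn0] : w \in geom M /\ w != 0.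
  by move: wGE; rewrite !inE => /andP[_ /andP[]].
have {wH} wH : w \notin H by move: wH; rewrite inE wn0 andbT.
have [HG _] := hyperplane_dim hH.
(* [p] projects [geom M] onto [H] along [w], and [elts M] is the preimage of its trace on [H]. *)
pose p x := if x \in H then x else x + w.
have pH x : x \in geom M -> p x \in H.
  by move=> xG; rewrite /p; case: ifPn => // xH; apply: (hyperplane_memD hH).
apply: (good_preimage (G := geom M) (f := p)) (good_isomorphic_sym gM0 isoM0).
- exact: elts_geom.
- move=> x y xG yG; rewrite /p.
  case: (boolP (x \in H)) => xH; case: (boolP (y \in H)) => yH.
  + by rewrite rpredD.
  + by rewrite rpredDl // (negPf yH) addrA.
  + by rewrite rpredDr // (negPf xH) addrAC.
  + by rewrite (hyperplane_memD hH) //; f2_cancel.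
move=> x xG; rewrite /p; case: ifPn => xH.
  rewrite !inE xH /=; apply/idP/andP => [xE|[]//].
  by rewrite xE (elts_neq0 xE).
have -> : (x \in elts M) = (x \in [set w + z | z in elts M :&: points H]).
  by rewrite {1}defE in_setU !in_setI [x \in points H]inE (negPf xH) andbF.
apply/imsetP/idP => [[z zE ->]|xwE]; first by rewrite addrC addxKx.
by exists (x + w) => //; rewrite addrCA addxx addr0.
Qed.

(* The I_4 condition is symmetric, so it may be checked on quadruples listing
   the elements satisfying [P] first. *)
Lemma quad_closed_sorted N (E : {set 'rV['F_2]_N}) (P : pred 'rV['F_2]_N) :
  (forall a b c d, a \in E -> b \in E -> c \in E -> d \in E ->
     P b ==> P a -> P c ==> P b -> P d ==> P c ->
     [|| a + b + c \in E, a + b + d \in E, a + c + d \in E, b + c + d \in E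
       | a + b + c + d \in E]) ->
  quad_closed E.
Proof.
pose Q (a b c d : 'rV['F_2]_N) := [|| a + b + c \in E, a + b + d \in E, a + c + d \in E,
  b + c + d \in E | a + b + c + d \in E].
move=> sortedQ a b c d aE bE cE dE; rewrite -/(Q a b c d).
have s12 (u v w t : 'rV_N) : Q u v w t = Q v u w t.
  by rewrite /Q (addrC v u) (orbCA (u + w + t \in E)).
have s23 (u v w t : 'rV_N) : Q u v w t = Q u w v t.
  by rewrite /Q (addrAC u w v) (addrC w v) (orbCA (u + v + t \in E)).
have s34 (u v w t : 'rV_N) : Q u v w t = Q u v t w.
  rewrite /Q (addrAC u t w) (addrAC v t w) (addrAC (u + v) t w).
  by rewrite (orbCA (u + v + w \in E)).
have sQ u v w t : u \in E -> v \in E -> w \in E -> t \in E ->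
  P v ==> P u -> P w ==> P v -> P t ==> P w -> Q u v w t by apply: sortedQ.
case Pa: (P a); case Pb: (P b); case Pc: (P c); case Pd: (P d);
  [> idtac | idtac | rewrite s34 | idtac | rewrite s23 s34 | rewrite s23
   | rewrite s34 s23 | idtac | rewrite s12 s23 s34 | rewrite s12 s23
   | rewrite s12 s34 s23 | rewrite s12 | rewrite s23 s12 s34 s23
   | rewrite s23 s12 | rewrite s34 s23 s12 | idtac];
  by apply: sQ; rewrite // ?Pa ?Pb ?Pc ?Pd.
Qed.

(** When two of the four coincide, a triple sum containing both reduces to its third term. *)
Lemma quad_closed_uniq N (E : {set 'rV['F_2]_N}) (a b c d : 'rV['F_2]_N) :
  a \in E -> b \in E -> c \in E -> d \in E ->
  (uniq [:: a; b; c; d] ->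
     [|| a + b + c \in E, a + b + d \in E, a + c + d \in E, b + c + d \in E
       | a + b + c + d \in E]) ->
  [|| a + b + c \in E, a + b + d \in E, a + c + d \in E, b + c + d \in E
    | a + b + c + d \in E].
Proof.
move=> aE bE cE dE; case: (boolP (uniq _)) => [_ /(_ isT) // | + _].
rewrite /= !inE andbT !negb_and !negbK -!orbA.
case/or4P=> [/eqP->|/eqP->|/eqP->|/or3P[]/eqP->].
- by rewrite addxx add0r cE.
- by rewrite addrAC addxx add0r bE.
- by rewrite (addrAC d b d) addxx add0r bE orbT.
- by rewrite -addrA addxx addr0 aE.
- by rewrite -(addrA a d d) addxx addr0 aE !orbT.
- by rewrite -(addrA a d d) addxx addr0 aE !orbT.
Qed.

(** Of [x], [y] and [x + y] only [y] lies in [G0] off [H0], so the symmetric difference deletes [y]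
    and adds the other two. *)
Lemma mem_AGstar N (H0 G0 : {vspace 'rV['F_2]_N}) (x y v : 'rV['F_2]_N) :
    x \notin G0 -> y \in G0 -> y \notin H0 ->
  (v \in symdiff (points G0 :\: points H0) [set x; y; x + y]) =
    [|| [&& v \in G0, v \notin H0 & v != y], v == x | v == x + y].
Proof.
move=> xG0 yG yH0; rewrite /symdiff !inE.
have yn0 : y != 0 by apply: contraNneq yH0 => ->; apply: mem0v.
have xn0 : x != 0 by apply: contraNneq xG0 => ->; apply: mem0v.
have [->|vx] := eqVneq v x; first by rewrite (negPf xG0) /= ?andbF ?orbT.
have [->|vy] := eqVneq v y.
  by rewrite yG (negPf yH0) yn0 /= eq_sym addx_eqr (negPf xn0).
have [->|vxy] := eqVneq v (x + y).
  by rewrite (rpredDr _ yG) (negPf xG0) /= !andbF.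
rewrite /= andbF !orbF; case: (boolP (v \in H0)) => [_|vH].
  by case: (v != 0); rewrite /= ?andbF.
have -> : v != 0 by apply: contraNneq vH => ->; apply: mem0v.
by rewrite !andbT.
Qed.

Lemma good_AGstar n N (M : matroid N) : is_AGstar n M -> good (elts M).
Proof.
case=> _ [H0 [G0 [x [y [hG0 hH0 xG yG defE]]]]].
pose B : pred 'rV['F_2]_N := fun v => [&& v \in G0, v \notin H0 & v != y].
move: xG yG; rewrite !inE => /andP[+ /andP[xG xn0]] /andP[+ /andP[yG yn0]].
rewrite xn0 yn0 !andbT => xG0 yH0.
have [HG _] := hyperplane_dim hH0; have {}HG := subvP HG.
have G0_0 v : v \notin H0 -> v != 0 by apply: contraNneq => ->; apply: mem0v.
have memE v : (v \in elts M) = [|| B v, v == x | v == x + y] by rewrite defE mem_AGstar.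
have H0E v : v \in H0 -> v \notin elts M.
  move=> vH; rewrite memE /B vH /= andbF /= negb_or; apply/andP; split.
    by apply: contraNneq xG0 => <-; apply: HG.
  by apply: contraNneq xG0 => def_v; rewrite -[x](addxKx y) addrC rpredD // addrC -def_v HG.
have BB u v : B u -> B v -> u + v \in H0.
  by case/and3P=> uG uH _ /and3P[vG vH _]; apply: (hyperplane_memD hH0).
have BBB u v w : B u -> B v -> B w -> u + v + w != y -> u + v + w \in elts M.
  move=> Bu Bv Bw ne; rewrite memE /B ne andbT; case/and3P: Bw => wG wH _.
  have uvH := BB _ _ Bu Bv.
  by rewrite (rpredDl _ (HG _ uvH)) wG (rpredDl _ uvH) wH.
have xE v : v \in G0 -> v != 0 -> v != y -> v + x \notin elts M.
  move=> vG v0 vy; rewrite memE /B (rpredDl _ vG) (negPf xG0) /= negb_or.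
  by rewrite addx_eqr v0 addrC (inj_eq (addrI _)).
have xyE v : v \in G0 -> v != 0 -> v != y -> v + (x + y) \notin elts M.
  move=> vG v0 vy; rewrite addrCA addrC xE ?rpredD ?addx_eq0 //.
  by rewrite addx_eqr.
have yE : y \notin elts M.
  rewrite memE /B eqxx !andbF /= negb_or; apply/andP; split.
    by apply: contraNneq xG0 => <-.
  by rewrite eq_sym addx_eqr.
have X a : a \in elts M -> ~~ B a -> a = x \/ a = x + y.
  by rewrite memE => /or3P[-> // | /eqP | /eqP]; [left | right].
have Bn0 v : B v -> [/\ v \in G0, v != 0 & v != y].
  by case/and3P=> vG /G0_0.
split.
  move=> a b aE bE; case: (boolP (B a)) => [Ba | /(X _ aE) aX];
    case: (boolP (B b)) => [Bb | /(X _ bE) bX].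
  - by rewrite H0E ?BB.
  - by have [aG a0 ay] := Bn0 _ Ba; case: bX => ->; rewrite ?xE ?xyE.
  - by have [bG b0 by_] := Bn0 _ Bb; rewrite addrC; case: aX => ->; rewrite ?xE ?xyE.
  case: aX bX => -> [] ->; rewrite ?addxx ?addxKx //.
  - by rewrite H0E ?mem0v.
  - by rewrite addrC addxKx.
  - by rewrite H0E ?mem0v.
apply: (quad_closed_sorted (P := B)) => a b c d aE bE cE dE ba cb dc.
apply: quad_closed_uniq => //; rewrite /= !inE !negb_or -!andbA.
case/and5P=> ab _ _ bc /and3P[bd cd _].
(* Three elements of [B] sum into [B] unless the sum is [y]. With four in [B], two triples cannot
   both give [y]; with three, the total is then [y + d], the other of [x] and [x + y]; with two,
   [c + d = y] and the total [a + b + y] lies in [B]. *)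
case: (boolP (B d)) dc => [Bd /= Bc | nBd _]; last case: (boolP (B c)) cb => [Bc /= Bb | nBc _].
- rewrite Bc /= in cb; rewrite cb /= in ba.
  have [eqy|ne] := eqVneq (a + b + c) y; last by rewrite BBB.
  rewrite (BBB a b d) ?orbT //; apply: contraNneq cd.
  by rewrite -eqy => /addrI->.
- rewrite Bb /= in ba.
  have [->|ne] := eqVneq (a + b + c) y; last by rewrite BBB.
  suff -> : y + d \in elts M by rewrite !orbT.
  case: (X _ dE nBd) => ->; first by rewrite memE [y + x]addrC eqxx !orbT.
  by rewrite addrCA addxx addr0 memE eqxx orbT.
have cdy : c + d = y.
  case: (X _ cE nBc) (X _ dE nBd) cd => -> [] ->; rewrite ?eqxx // => _.
    by rewrite addxKx.
  by rewrite addrC addxKx.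
case: (boolP (B b)) ba => [Bb /= Ba | nBb _]; last first.
  by case: (X _ cE nBc) (X _ dE nBd) (X _ bE nBb) cd bc bd => -> [] -> [] ->; rewrite ?eqxx.
rewrite [a + b + c + d](_ : _ = a + b + y); last by rewrite -cdy addrA.
have abH := BB _ _ Ba Bb.
rewrite [X in [|| _, _, _, _ | X]]memE /B (rpredDl _ (HG _ abH)) yG (rpredDl _ abH) yH0 /=.
by rewrite addx_eqr addx_eq0 ab !orbT.
Qed.

Lemma good_expansions N (M : matroid N) : obtained_by_expansions M -> good (elts M).
Proof.
elim=> {N M} [N M | N M M' _ gM [_ _ ->] | N M M' _ gM | N1 N2 M1 M2 _ gM] //.
- exact: good_dim1.
- exact: good_1_expansion.
- exact: good_isomorphic.
Qed.

Lemma good_doublings N (M : matroid N) : obtained_by_doublings M -> good (elts M).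
Proof.
elim=> {N M} [n N M _ | N0 N M0 M _ gM | N1 N2 M1 M2 _ gM].
- exact: good_AGstar.
- exact: good_doubling.
- exact: good_isomorphic.
Qed.

(** * A decision procedure for finite configurations *)

(* The bits of [m] select the terms of the sum, so that [N.lxor] is addition. *)
Fixpoint comb N (xs : seq 'rV['F_2]_N) (m : BinNums.N) : 'rV['F_2]_N :=
  if xs is x :: xs' then (if N.odd m then x else 0) + comb xs' (N.div2 m) else 0.

Lemma comb_lxor N (xs : seq 'rV['F_2]_N) m1 m2 :
  comb xs (N.lxor m1 m2) = comb xs m1 + comb xs m2.
Proof.
elim: xs m1 m2 => [|x xs IHxs] m1 m2 /=; first by rewrite addr0.
rewrite N.div2_spec N.shiftr_lxor -!N.div2_spec IHxs.
rewrite -!N.bit0_odd N.lxor_spec addrACA.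
by case: (N.testbit m1 _); case: (N.testbit m2 _); rewrite /= ?addxx ?addr0 ?add0r.
Qed.

Fixpoint subseqs_of_size (k : nat) (s : seq N) : seq (seq N) :=
  match k, s with
  | 0, _ => [:: [::]]
  | _.+1, [::] => [::]
  | k'.+1, x :: s' =>
      [seq x :: t | t <- subseqs_of_size k' s'] ++ subseqs_of_size k s'
  end.

Definition quad_sums (q : seq N) : seq N :=
  if q is [:: a; b; c; d] then
    let ab := N.lxor a b in let cd := N.lxor c d in
    [:: N.lxor ab c; N.lxor ab d; N.lxor a cd; N.lxor b cd; N.lxor ab cd]
  else [::].

Definition pair_sums (s : seq N) : seq N := [seq N.lxor a b | a <- s, b <- s].

(** A quadruple of known members with no sum known yet forces one of its five sums into the set;
    sums of two known members are discarded beforehand by sum-freeness. *)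
Definition branches (pos : seq N) : seq (seq N) :=
  let neg := undup (pair_sums pos) in
  [seq [seq m <- quad_sums q | m \notin neg] |
     q <- subseqs_of_size 4 pos & ~~ has (mem pos) (quad_sums q)].

(** Branching on the fewest options keeps the search tree small; an empty list of options closes the
    branch. *)
Definition shortest (l : seq N) (ls : seq (seq N)) : seq N :=
  foldl (fun l1 l2 => if (size l2 < size l1)%N then l2 else l1) l ls.

(* Searches for a good set containing the combinations in [pos] but including
   no member of [goals]; [true] means that there is none. *)
Fixpoint search (goals : seq (seq N)) (n : nat) (pos : seq N) : bool :=
  if n is n'.+1 then
    if has (mem pos) (pair_sums pos) then true else
    if has (all (mem pos)) goals then true else
    if branches pos is l :: ls then
      all (fun m => search goals n' (m :: pos)) (shortest l ls)
    else false
  else false.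

Lemma subseqs_of_size_sub k s q : q \in subseqs_of_size k s -> {subset q <= s}.
Proof.
elim: s k q => [|x s IHs] [|k] q //=; rewrite ?inE; try by move/eqP->.
rewrite mem_cat => /orP[/mapP[t /IHs ts ->]|/IHs qs] m; rewrite !inE.
  by case/orP=> [->//|/ts->]; rewrite orbT.
by move/qs->; rewrite orbT.
Qed.

Lemma shortest_mem l ls : shortest l ls \in l :: ls.
Proof.
elim: ls l => [|l' ls IHls] l; first by rewrite mem_seq1.
rewrite /shortest /= -/(shortest _ _); have := IHls (if (size l' < size l)%N then l' else l).
by case: ifP => _; rewrite !inE => /orP[]->; rewrite ?orbT.
Qed.

Section SearchSound.
Variables (N : nat) (E : {set 'rV['F_2]_N}) (xs : seq 'rV['F_2]_N).
Hypothesis goodE : good E.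
Local Notation inE_ := (fun m => comb xs m \in E).

Lemma pair_sums_notin pos m : all inE_ pos -> m \in pair_sums pos -> ~~ inE_ m.
Proof.
move=> /allP posE /allpairsP[[a b] /= [ap bp ->]].
by rewrite comb_lxor goodE.1 ?posE.
Qed.

Lemma quad_sums_has q : size q = 4 -> all inE_ q -> has inE_ (quad_sums q).
Proof.
case: q => [|a [|b [|c [|d [|]]]]] //= _; rewrite andbT => /and4P[aE bE cE dE].
have := goodE.2 _ _ _ _ aE bE cE dE; rewrite !comb_lxor !addrA orbF.
by [].
Qed.

Lemma subseqs_of_size_size k s q : q \in subseqs_of_size k s -> size q = k.
Proof.
elim: s k q => [|x s IHs] [|k] q //=; rewrite ?inE; try by move/eqP->.
by rewrite mem_cat => /orP[/mapP[t /IHs <- ->]|/IHs].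
Qed.

(** [E] itself follows one branch: the chosen quadruple has a sum in [E], and this sum survives the
    filter. Only the linearity of [comb] enters, so [xs] may be linearly dependent. *)
Lemma searchP goals n pos : search goals n pos -> all inE_ pos ->
  has (all inE_) goals.
Proof.
elim: n pos => [|n IHn] pos //=; case: hasP => [[m mpp mpos] _ posE | _].
  by have := pair_sums_notin posE mpp; rewrite (allP posE).
case: hasP => [[g gg /allP gpos] _ /allP posE | _].
  by apply/hasP; exists g => //; apply/allP => m /gpos/posE.
case def_b: (branches pos) => [//|l ls] /allP brE posE.
have := shortest_mem l ls; rewrite -def_b => /mapP[q].
rewrite mem_filter => /andP[_ qpos] def_l.
have : has inE_ (quad_sums q).
  apply: quad_sums_has; first exact: subseqs_of_size_size qpos.
  by apply/allP => m /(subseqs_of_size_sub qpos)/(allP posE).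
case/hasP=> m mq mE; have /IHn : search goals n (m :: pos).
  apply: brE; rewrite def_l mem_filter mq andbT mem_undup.
  by apply: contraTN mE => /(pair_sums_notin posE).
by apply; rewrite /= mE.
Qed.

End SearchSound.

(** * Non-affine sets *)

(** In a sum-free [E] the five elements are distinct, since a repetition would leave three elements
    with sum zero. *)
Definition pentagon N (E : {set 'rV['F_2]_N}) (c1 c2 c3 c4 c5 : 'rV['F_2]_N) : Prop :=
  {subset [:: c1; c2; c3; c4; c5] <= E} /\ c1 + c2 + c3 + c4 + c5 = 0.

(** A nonzero period [t] of [E] is the point [w] of a doubling. *)
Definition aperiodic N (E : {set 'rV['F_2]_N}) : Prop :=
  forall t, {in E, forall v, t + v \in E} -> t = 0.

Section Pentagon.
Variables (N : nat) (E : {set 'rV['F_2]_N}).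
Hypothesis goodE : good E.
Implicit Types c v w : 'rV['F_2]_N.

Lemma pentagon_perm c1 c2 c3 c4 c5 d1 d2 d3 d4 d5 :
  perm_eq [:: d1; d2; d3; d4; d5] [:: c1; c2; c3; c4; c5] ->
  pentagon E c1 c2 c3 c4 c5 -> pentagon E d1 d2 d3 d4 d5.
Proof.
move=> pdc [CE C0]; split=> [x|]; first by rewrite (perm_mem pdc) => /CE.
have : \sum_(x <- [:: d1; d2; d3; d4; d5]) x = \sum_(x <- [:: c1; c2; c3; c4; c5]) x.
  exact: perm_big.
by rewrite !big_cons !big_nil /= !addr0 !addrA C0.
Qed.

Variables (c1 c2 c3 c4 c5 : 'rV['F_2]_N).
Hypothesis pentC : pentagon E c1 c2 c3 c4 c5.

Local Notation cs := [:: c1; c2; c3; c4; c5].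

(* In terms of [:: c1; c2; c3; c4; v; w]: 1, 2, 4, 8 and 15 stand for the
   pentagon, 16 for [v] and 32 for [w]. *)
Local Notation pent := [:: 1; 2; 4; 8; 15]%num.
Let star (t : BinNums.N) : seq BinNums.N := map (N.lxor t) pent.
Let triple (t a b c : BinNums.N) : seq BinNums.N :=
  [:: N.lxor t (N.lxor a b); N.lxor t (N.lxor a c); N.lxor t (N.lxor b c)].

Local Notation K v w := (comb [:: c1; c2; c3; c4; v; w]).
Local Notation inK v w := (fun m => K v w m \in E).
Local Ltac perm5 := let p := fresh "p" in apply/permP => p /=;
  by move: (p c1) (p c2) (p c3) (p c4) (p c5) => [] [] [] [] [].
Local Arguments N.lxor : simpl never.
Local Arguments comb : simpl never.

Lemma pentagon_mem : [/\ c1 \in E, c2 \in E, c3 \in E, c4 \in E & c5 \in E].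
Proof. by split; apply: pentC.1; rewrite !inE eqxx ?orbT. Qed.

Lemma pentagon_last : c1 + c2 + c3 + c4 = c5.
Proof. by apply/eqP; rewrite -addx_eq0 pentC.2. Qed.

Lemma combE v w :
  (K v w 0 = 0) * (K v w 1 = c1) * (K v w 2 = c2) * (K v w 4 = c3) * (K v w 8 = c4) *
  (K v w 15 = c5) * (K v w 16 = v) * (K v w 32 = w).
Proof.
by rewrite /comb /= !(add0r, addr0) !addrA pentagon_last.
Qed.

Let all_cons (p : pred BinNums.N) x s : all p (x :: s) = p x && all p s.
Proof. by []. Qed.

Let has_cons (p : pred (seq BinNums.N)) x s : has p (x :: s) = p x || has p s.
Proof. by []. Qed.

Let simpE v w := (@comb_lxor N, combE v w).

Lemma pent_mem v w : all (inK v w) pent.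
Proof. by case: pentagon_mem => h1 h2 h3 h4 h5; rewrite /= !combE h1 h2 h3 h4 h5. Qed.

Lemma all_star v w t : all (inK v w) (star t) = all (fun x => K v w t + x \in E) cs.
Proof. by rewrite /= !simpE. Qed.

Lemma all_triple v w t m1 m2 m3 :
  all (inK v w) (triple t m1 m2 m3) =
  [&& K v w t + (K v w m1 + K v w m2) \in E, K v w t + (K v w m1 + K v w m3) \in E
    & K v w t + (K v w m2 + K v w m3) \in E].
Proof. by rewrite /= !simpE andbT. Qed.

Lemma star_period v : {in cs, forall x, v + x \in E} -> {in E, forall w, v + w \in E}.
Proof.
move=> vC w wE.
have : has (all (inK v w)) [:: [:: N.lxor 16 32]].
  (* The bound 20 is fuel: running out yields [false], so the success of the computation shows that
     it suffices. *)
  apply: (searchP goodE (n := 20) (pos := 32%num :: star 16 ++ pent)).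
    by vm_compute.
  by rewrite all_cons all_cat all_star pent_mem !simpE wE andbT; apply/allP.
by rewrite /= !simpE !orbF !andbT.
Qed.

Hypothesis aperE : aperiodic E.

Lemma star_centre v : all (fun x => v + x \in E) cs -> v = 0.
Proof. by move/allP/star_period/aperE. Qed.

(** The search leaves five stars through [v], centred at the [v + ci], and ten triples. By
    aperiodicity such a centre is 0, which puts [v] in the pentagon. *)
Lemma triple_exists v : v \in E -> v \notin cs -> exists d1 d2 d3 d4 d5,
  [/\ perm_eq [:: d1; d2; d3; d4; d5] cs, v + (d1 + d2) \in E, v + (d1 + d3) \in E
    & v + (d2 + d3) \in E].
Proof.
move=> vE vC.
have : has (all (inK v 0)) ([seq star (N.lxor 16 m) | m <- pent] ++
    [:: triple 16 1 2 4; triple 16 1 2 8; triple 16 1 2 15; triple 16 1 4 8;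
        triple 16 1 4 15; triple 16 1 8 15; triple 16 2 4 8; triple 16 2 4 15;
        triple 16 2 8 15; triple 16 4 8 15])%num.
  apply: (searchP goodE (n := 20) (pos := 16%num :: pent)); first by vm_compute.
  by rewrite all_cons pent_mem !simpE vE.
rewrite has_cat => /orP[/hasP[_ /mapP[m mpent ->]]|].
  rewrite all_star comb_lxor combE => /star_centre/eqP; rewrite addx_eq0 => /eqP def_v.
  case/negP: vC; rewrite def_v; move: m mpent {def_v}; apply/allP.
  by rewrite /= !combE !inE !eqxx !orbT.
rewrite /has !all_triple !combE.
case/orP=> [/and3P[? ? ?]|]; first by exists c1, c2, c3, c4, c5; split=> //; perm5.
case/orP=> [/and3P[? ? ?]|]; first by exists c1, c2, c4, c3, c5; split=> //; perm5.
case/orP=> [/and3P[? ? ?]|]; first by exists c1, c2, c5, c3, c4; split=> //; perm5.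
case/orP=> [/and3P[? ? ?]|]; first by exists c1, c3, c4, c2, c5; split=> //; perm5.
case/orP=> [/and3P[? ? ?]|]; first by exists c1, c3, c5, c2, c4; split=> //; perm5.
case/orP=> [/and3P[? ? ?]|]; first by exists c1, c4, c5, c2, c3; split=> //; perm5.
case/orP=> [/and3P[? ? ?]|]; first by exists c2, c3, c4, c1, c5; split=> //; perm5.
case/orP=> [/and3P[? ? ?]|]; first by exists c2, c3, c5, c1, c4; split=> //; perm5.
case/orP=> [/and3P[? ? ?]|]; first by exists c2, c4, c5, c1, c3; split=> //; perm5.
case/orP=> [/and3P[? ? ?]|]; first by exists c3, c4, c5, c1, c2; split=> //; perm5.
by [].
Qed.

(** Aperiodicity makes the centre [t + m] of a star vanish, so each star among the goals of a search
    becomes an equation [t = m]. *)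
Lemma stars_centre v w t ms : has (all (inK v w)) [seq star (N.lxor t m) | m <- ms] ->
  exists2 m, m \in ms & K v w t = K v w m.
Proof.
case/hasP=> _ /mapP[m mms ->]; rewrite all_star comb_lxor => /star_centre/eqP.
by rewrite addx_eq0 => /eqP; exists m.
Qed.

Lemma stars_pent v w t : has (all (inK v w)) [seq star (N.lxor t m) | m <- pent] ->
  K v w t \in cs.
Proof.
case/stars_centre=> m + ->; move: m; apply/allP.
by rewrite /= !combE !inE !eqxx !orbT.
Qed.

Section Triple.
Variable v : 'rV['F_2]_N.
Hypotheses (vE : v \in E) (v12 : v + (c1 + c2) \in E)
  (v13 : v + (c1 + c3) \in E) (v23 : v + (c2 + c3) \in E).

Let span_v w : v + w \in [:: 0; c1 + c2; c1 + c3; c2 + c3] ->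
  [\/ w = v, w = v + (c1 + c2), w = v + (c1 + c3) | w = v + (c2 + c3)].
Proof.
rewrite !inE => /or4P[]/eqP def_w; rewrite -[w](addxKx v) def_w ?addr0;
  first [by constructor 1 | by constructor 2 | by constructor 3 | by constructor 4].
Qed.

Let centres w : has (all (inK v w)) [seq star (N.lxor (N.lxor 16 32) m)
    | m <- [:: 0; N.lxor 1 2; N.lxor 1 4; N.lxor 2 4]]%num ->
  v + w \in [:: 0; c1 + c2; c1 + c3; c2 + c3].
Proof.
case/stars_centre=> m; rewrite comb_lxor !combE => + ->; move: m; apply/allP.
by rewrite all_cons /= !simpE !inE !eqxx !orbT.
Qed.

(** Besides the claim, the search allows stars around [w + ci], which put [w] in the pentagon, and
    around [v + w + g] with [g] in the group {0, c1+c2, c1+c3, c2+c3}. The latter put [w] in the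
    coset of [v] modulo this group, which lies in [E]. *)
Lemma triple_unique w : w \in E -> w \notin cs ->
  [/\ w + (c1 + c2) \in E, w + (c1 + c3) \in E & w + (c2 + c3) \in E].
Proof.
move=> wE wC.
have : has (all (inK v w)) (triple 32 1 2 4 ::
  [seq star (N.lxor 32 m) | m <- pent] ++
  [seq star (N.lxor (N.lxor 16 32) m) | m <- [:: 0; N.lxor 1 2; N.lxor 1 4; N.lxor 2 4]])%num.
  apply: (searchP goodE (n := 20) (pos := 32 :: 16 :: triple 16 1 2 4 ++ pent)%num).
    by vm_compute.
  by rewrite 2!all_cons all_cat all_triple pent_mem !combE wE vE v12 v13 v23.
rewrite has_cons has_cat all_triple !combE => /orP[/and3P//|/orP[/stars_pent|/centres/span_v]].
  by rewrite combE (negPf wC).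
by case=> ->; split=> //; rewrite -?addrA;
  match goal with |- is_true (_ + ?s \in _) =>
    first [ rewrite (_ : s = 0) ?addr0 //; f2_cancel
          | rewrite (_ : s = c1 + c2) //; f2_cancel
          | rewrite (_ : s = c1 + c3) //; f2_cancel
          | rewrite (_ : s = c2 + c3) //; f2_cancel ] end.
Qed.

Lemma triple_sum w : w \in E -> w \notin cs -> v != w -> v + w + (c4 + c5) \in E.
Proof.
move=> wE wC vw.
have : has (all (inK v w)) ([:: N.lxor (N.lxor 16 32) (N.lxor 8 15)] ::
  [seq star (N.lxor 32 m) | m <- pent] ++
  [seq star (N.lxor (N.lxor 16 32) m) | m <- [:: 0; N.lxor 1 2; N.lxor 1 4; N.lxor 2 4]])%num.
  apply: (searchP goodE (n := 20) (pos := 32 :: 16 :: triple 16 1 2 4 ++ pent)%num).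
    by vm_compute.
  by rewrite 2!all_cons all_cat all_triple pent_mem !combE wE vE v12 v13 v23.
rewrite has_cons has_cat all_cons !simpE andbT => /orP[//|/orP[/stars_pent|/centres]].
  by rewrite combE (negPf wC).
have [h1 h2 h3 _ _] := pentagon_mem; have C0 := pentC.2.
(* If [v + w] is the sum of two of [c1], [c2], [c3], adding [c4 + c5] gives the third, because the
   pentagon sums to zero. *)
rewrite !inE addx_eq0 (negPf vw) /= => /or3P[] /eqP->.
- by rewrite (_ : _ + _ = c3) //; apply/eqP; rewrite -addx_eq0 -C0; apply/eqP; f2_cancel.
- by rewrite (_ : _ + _ = c2) //; apply/eqP; rewrite -addx_eq0 -C0; apply/eqP; f2_cancel.
- by rewrite (_ : _ + _ = c1) //; apply/eqP; rewrite -addx_eq0 -C0; apply/eqP; f2_cancel.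
Qed.

End Triple.

End Pentagon.

(** * Pentagons in non-affine sets, and the aperiodic case *)

Lemma odd_sum_pentagon N (E : {set 'rV['F_2]_N}) (l : seq 'rV['F_2]_N) :
  good E -> {subset l <= E} -> odd (size l) -> \sum_(x <- l) x = 0 ->
  exists c1 c2 c3 c4 c5, pentagon E c1 c2 c3 c4 c5.
Proof.
case=> sfE qcE; have [n] := ubnP (size l); elim: n l => // n IHn l ln lE odd_l l0.
case: l ln lE odd_l l0 => [|a [|b [|c [|d r]]]] //= ln lE odd_l l0.
- case/negP: (sumfree0 sfE); rewrite -l0 big_seq1.
  by apply: lE; rewrite inE.
- have [aE bE cE] : [/\ a \in E, b \in E & c \in E] by split; apply: lE; rewrite !inE eqxx ?orbT.
  case/negP: (sfE a b aE bE); move/eqP: l0.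
  by rewrite !big_cons big_nil addr0 addrA addx_eq0 => /eqP->.
have [aE bE cE dE] : [/\ a \in E, b \in E, c \in E & d \in E].
  by split; apply: lE; rewrite !inE eqxx ?orbT.
have rE x : x \in r -> x \in E by move=> xr; apply: lE; rewrite !inE xr !orbT.
(* A triple sum in [E] replaces four terms by two with the same sum, which keeps the parity of the
   length; failing that, [a + b + c + d] lies in [E] and closes a pentagon. *)
have shorter u v : u \in E -> v \in E -> u + v = a + b + c + d ->
    exists c1 c2 c3 c4 c5, pentagon E c1 c2 c3 c4 c5.
  move=> uE vE uv; apply: (IHn [:: u, v & r]) => //=.
  - exact: ltnW ln.
  - by move=> x; rewrite !inE => /or3P[/eqP->|/eqP->|/rE].
  - by move: odd_l; rewrite !negbK.
  by move: l0; rewrite !big_cons !addrA uv.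
have /or4P[abc|abd|acd|/orP[bcd|abcd]] := qcE a b c d aE bE cE dE.
- exact: shorter abc dE _.
- by apply: shorter abd cE _; rewrite addrAC.
- by apply: shorter acd bE _; rewrite addrAC -[a + c + b]addrA [c + b]addrC addrA.
- by apply: shorter bcd aE _; rewrite addrC !addrA.
exists a, b, c, d, (a + b + c + d); split; last by rewrite addxx.
by move=> x; rewrite !inE => /or4P[/eqP->|/eqP->|/eqP->|/orP[]/eqP->].
Qed.

(** For [e] in [E], let [K] be the span of [e + E]. A hyperplane containing [K] but not [e] avoids
    [E]; if [e] lies in [K], writing it as a sum of generators yields an odd zero-sum list. *)
Lemma affine_or_pentagon N (M : matroid N) : good (elts M) -> elts M != set0 ->
  affine M \/ exists c1 c2 c3 c4 c5, pentagon (elts M) c1 c2 c3 c4 c5.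
Proof.
move=> gM /set0Pn[e eE]; pose K := <<[seq (e + a)%R | a <- enum (elts M)]>>%VS.
have KG : (K <= geom M)%VS.
  apply/span_subvP => _ /mapP[a aE ->].
  by rewrite rpredD ?elts_geom // -mem_enum.
have [eK|eK] := boolP (e \in K); [right | left].
  have [t tE def_e] := mem_span_sum eK.
  have [l lE def_t] : exists2 l, {subset l <= elts M} & t = [seq e + a | a <- l].
    elim: t tE {def_e} => [|x t IHt] tE; first by exists [::].
    have [|l lE ->] := IHt; first by move=> y yt; apply: tE; rewrite inE yt orbT.
    have /mapP[a aE ->] : x \in [seq e + a | a <- enum (elts M)] by apply: tE; rewrite inE eqxx.
    exists (a :: l) => // y; rewrite inE => /orP[/eqP->|/lE//].
    by rewrite -mem_enum.
  have sum_t : \sum_(x <- t) x = (if odd (size l) then e else 0) + \sum_(x <- l) x.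
    rewrite def_t big_map; elim: (l) => [|a s IHs]; first by rewrite !big_nil addr0.
    rewrite !big_cons {}IHs /=; case: (odd _); last by f2_cancel.
    by rewrite add0r; f2_cancel.
  (* For odd length the copies of [e] cancel and [l] sums to zero; for even length [l] sums to [e],
     and [e :: l] is the odd list. *)
  rewrite sum_t in def_e; case: (boolP (odd (size l))) def_e => odd_l def_e.
    apply: (odd_sum_pentagon gM lE odd_l).
    by rewrite -[LHS](addxKx e) -def_e addxx.
  apply: (odd_sum_pentagon (l := e :: l) gM).
  - by move=> x; rewrite inE => /orP[/eqP->|/lE].
  - by rewrite /= odd_l.
  by rewrite big_cons {1}def_e add0r addxx.
have [H [KH eH hH]] := exists_hyperplane KG (elts_geom eE) eK.
exists H; split=> //; apply/subsetP => a aE.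
rewrite !inE (elts_neq0 aE) (elts_geom aE) !andbT /=; apply: contra eH => aH.
rewrite -[e](addxKx a) rpredD // (subvP KH) // addrC memv_span //.
by apply: map_f; rewrite mem_enum.
Qed.

(** [c4] and [c5] become the two elements of AG* off [G0], and [c4 + c5] its deleted point [y]; the
    conclusion makes the rest of [E], translated by [y], closed under sums of distinct elements. *)
Lemma pentagon_closure N (E : {set 'rV['F_2]_N}) b1 b2 b3 b4 b5 :
  good E -> aperiodic E -> pentagon E b1 b2 b3 b4 b5 ->
  exists c1 c2 c3 c4 c5, pentagon E c1 c2 c3 c4 c5 /\
    {in E &, forall v w, v \notin [:: c4; c5] -> w \notin [:: c4; c5] -> v != w ->
       v + w + (c4 + c5) \in E}.
Proof.
move=> gE aE pentB.
suff [c1 [c2 [c3 [c4 [c5 [pentC triC]]]]]] : exists c1 c2 c3 c4 c5,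
    pentagon E c1 c2 c3 c4 c5 /\ forall w, w \in E -> w \notin [:: c1; c2; c3; c4; c5] ->
      [/\ w + (c1 + c2) \in E, w + (c1 + c3) \in E & w + (c2 + c3) \in E].
  exists c1, c2, c3, c4, c5; split=> // v w vE wE vC wC vw.
  have [h1 h2 h3 h4 h5] := pentagon_mem pentC; have C0 := pentC.2.
  have eq_sum u t : u + t + (c1 + c2 + c3 + c4 + c5) \in E -> u + t \in E.
    by rewrite C0 addr0.
  (* By symmetry, the case where only [v] is among [c1], [c2], [c3] reduces to the case where only
     [w] is. *)
  wlog vP : v w vE wE vC wC vw / (v \notin [:: c1; c2; c3]) || (w \in [:: c1; c2; c3]).
    move=> IH; case: (boolP (v \in [:: c1; c2; c3])) => [v3|v3]; last first.
      by apply: IH => //; rewrite v3.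
    case: (boolP (w \in [:: c1; c2; c3])) => [w3|w3]; first by apply: IH => //; rewrite w3 orbT.
    by rewrite [v + w]addrC; apply: IH => //; rewrite ?w3 // eq_sym.
  case: (boolP (v \in [:: c1; c2; c3])) vP => [v3 /= w3 | v3 _].
    move: v3 w3 vw; rewrite !inE => /or3P[]/eqP-> /or3P[]/eqP->;
    rewrite ?eqxx // => _; apply: eq_sum;
    match goal with |- is_true (?s \in _) =>
      first [ by rewrite (_ : s = c1) //; f2_cancel | by rewrite (_ : s = c2) //; f2_cancel
            | by rewrite (_ : s = c3) //; f2_cancel ] end.
  have /(triC v vE)[v12 v13 v23] : v \notin [:: c1; c2; c3; c4; c5].
    rewrite (_ : [:: c1; c2; c3; c4; c5] = [:: c1; c2; c3] ++ [:: c4; c5]) //.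
    by rewrite mem_cat negb_or v3.
  have [w3|w3] := boolP (w \in [:: c1; c2; c3]).
    apply: eq_sum; move: w3; rewrite !inE => /or3P[]/eqP->.
    - by rewrite (_ : _ + _ = v + (c2 + c3)) //; f2_cancel.
    - by rewrite (_ : _ + _ = v + (c1 + c3)) //; f2_cancel.
    - by rewrite (_ : _ + _ = v + (c1 + c2)) //; f2_cancel.
  apply: (triple_sum gE pentC aE) => //.
  rewrite (_ : [:: c1; c2; c3; c4; c5] = [:: c1; c2; c3] ++ [:: c4; c5]) //.
  by rewrite mem_cat negb_or w3.
(* If [E] is the pentagon alone, any labelling works, as no [w] lies off it. *)
have [EC|] := boolP (E \subset [:: b1; b2; b3; b4; b5]).
  by exists b1, b2, b3, b4, b5; split=> // w wE; rewrite (subsetP EC).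
case/subsetPn=> v vE vB.
have [c1 [c2 [c3 [c4 [c5 [pCB v12 v13 v23]]]]]] := triple_exists gE pentB aE vE vB.
have pentC := pentagon_perm pCB pentB.
exists c1, c2, c3, c4, c5; split=> // w wE wC.
exact: (triple_unique gE pentC aE vE).
Qed.

Lemma aperiodic_AGstar N (M : matroid N) b1 b2 b3 b4 b5 :
  good (elts M) -> full_rank M -> aperiodic (elts M) ->
  pentagon (elts M) b1 b2 b3 b4 b5 -> exists2 n, (3 <= n)%N & is_AGstar n M.
Proof.
move=> gM frM apM /(pentagon_closure gM apM)[c1 [c2 [c3 [c4 [c5 [pentC clC]]]]]].
have [h1 h2 h3 h4 h5] := pentagon_mem pentC; have C0 := pentC.2.
have sfE := gM.1; pose y := c4 + c5; have y_E : y \notin elts M by apply: sfE.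
have xy : c4 + y = c5 by rewrite addxKx.
have no3 u v w : u \in elts M -> v \in elts M -> w \in elts M -> u + v + w != 0.
  by move=> uE vE wE; rewrite addx_eq0; apply: contraTneq wE => <-; apply: sfE.
have c45 : c4 != c5.
  apply: contra (no3 _ _ _ h1 h2 h3) => /eqP c45; move: C0.
  by rewrite c45 -addrA addxx addr0 => ->.
have y0 : y != 0 by rewrite addx_eq0.
(* [A] becomes [H0]: it is the translate by [y] of [y] together with [E] without [c4] and [c5]. *)
pose A := [set h | (h == 0) || (y + h \in elts M) && (y + h \notin [:: c4; c5])].
have [H0 memH0] : exists U : {vspace 'rV['F_2]_N}, U =i A.
  apply: closed_vspace => [|h k]; first by rewrite !inE eqxx.
  rewrite !inE.
  have [->|h0] := eqVneq h 0; first by rewrite add0r.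
  have [->|k0] := eqVneq k 0; first by rewrite /= => hA _; rewrite addr0 hA orbT.
  rewrite !orFb => /andP[hE hC] /andP[kE kC].
  have [//|hk0] := eqVneq (h + k) 0.
  have hkE : y + (h + k) \in elts M.
    rewrite (_ : y + (h + k) = (y + h) + (y + k) + (c4 + c5)); last by rewrite /y; f2_cancel.
    by apply: clC; rewrite ?inE //; apply: contra hk0 => /eqP/addrI->; rewrite addxx.
  (* If the new element were [c4] or [c5], the other of the two would be a sum of two elements of
     [E]. *)
  rewrite hkE /= negb_or; apply/andP; split.
    apply: contraTneq h5 => e4; have -> : c5 = (y + h) + (y + k); last exact: sfE.
    by rewrite -xy -e4 /y; f2_cancel.
  apply: contraTneq h4 => e5; have -> : c4 = (y + h) + (y + k); last exact: sfE.
  have -> : c4 = y + c5 by rewrite /y; f2_cancel.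
  by rewrite -e5; f2_cancel.
have memH0' h : (h \in H0) = (h == 0) || (y + h \in elts M) && (y + h \notin [:: c4; c5]).
  by rewrite memH0 inE.
have yH0 : y \notin H0 by rewrite memH0' addxx (negPf (sumfree0 sfE)) orbF.
have EH0 v : v \in elts M -> v \notin [:: c4; c5] -> y + v \in H0.
  by move=> vE vC; rewrite memH0' addxKx vE vC orbT.
have EH0' v : v \in H0 -> v \notin elts M.
  move=> vH; apply/negP => vE; have [v45|v45] := boolP (v \in [:: c4; c5]); last first.
    case/negP: yH0; rewrite -[y](addxKx v) rpredD //.
    by rewrite addrC EH0.
  move: vH; rewrite memH0' (negPf (elts_neq0 vE)) /=.
  move: v45; rewrite !inE => /orP[]/eqP->; rewrite /y.
    by rewrite (_ : _ + _ = c5) ?eqxx ?orbT ?andbF //; f2_cancel.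
  by rewrite -addrA addxx addr0 eqxx andbF.
pose G0 := (H0 + <[y]>)%VS.
have c4G0 : c4 \notin G0.
  rewrite mem_adjoin negb_or; apply/andP; split; first by apply/negP => /EH0'; rewrite h4.
  by rewrite xy; apply/negP => /EH0'; rewrite h5.
have yG0 : y \in G0 by rewrite mem_adjoin addxx mem0v orbT.
have defG : geom M = (G0 + <[c4]>)%VS.
  have EG v : v \in elts M -> v \in (G0 + <[c4]>)%VS.
    move=> vE; rewrite mem_adjoin; have [|v45] := boolP (v \in [:: c4; c5]).
      rewrite !inE => /orP[]/eqP->; first by rewrite addxx mem0v orbT.
      by rewrite addrC -/y yG0 orbT.
    by rewrite [v \in G0]mem_adjoin [v + y]addrC EH0 // orbT.
  apply/subv_anti/andP; split.
    by rewrite -{1}frM; apply/span_subvP => v; rewrite mem_enum; apply: EG.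
  have yG : y \in geom M by rewrite rpredD ?elts_geom.
  rewrite !subv_add -!memvE yG elts_geom // !andbT.
  apply/subvP => h; rewrite memH0' => /orP[/eqP->|/andP[yhE _]]; first exact: mem0v.
  by rewrite -[h](addxKx y) rpredD // elts_geom.
have hH0 : hyperplane H0 G0 by apply: adjoin_hyperplane.
have hG0 : hyperplane G0 (geom M) by rewrite defG; apply: adjoin_hyperplane.
(* AG*(n-1,2) has dimension [n + 1]. The independent vectors [y + c1] and [y + c2] lie in [H0], of
   codimension two, so the dimension is at least 4. *)
exists (mdim M).-1.
  have [_ dG] := hyperplane_dim hG0; have [_ dG0] := hyperplane_dim hH0.
  rewrite /mdim dG dG0 /= ltnS.
  have neqC u v w p q : p \in elts M -> q \in elts M -> w \in elts M ->
      u + v + (w + p + q) = c1 + c2 + c3 + c4 + c5 -> u != v.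
    move=> pE qE wE sumC; have := no3 w p q wE pE qE; apply: contraNneq => uv.
    by rewrite -C0 -sumC uv addxx add0r.
  have yc_neq0 c : c \in elts M -> y + c \notin (0%VS : {vspace 'rV['F_2]_N}).
    by move=> cE; rewrite memv0 addx_eq0; apply: contraNneq y_E => ->.
  have d2 : \dim (0 + <[y + c1]> + <[y + c2]>) = 2%N.
    rewrite !dimv_add_line ?dimv0 ?yc_neq0 // mem_adjoin (negPf (yc_neq0 _ h2)) /=.
    rewrite memv0 addx_eq0 (inj_eq (addrI _)) eq_sym.
    by apply: (neqC _ _ c3 c4 c5) => //; f2_cancel.
  suff : (0 + <[y + c1]> + <[y + c2]> <= H0)%VS by move/dimvS; rewrite d2.
  rewrite !subv_add sub0v -!memvE !EH0 // !inE negb_or; apply/andP; split.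
  - by apply: (neqC _ _ c1 c3 c5) => //; f2_cancel.
  - by apply: (neqC _ _ c1 c3 c4) => //; f2_cancel.
  - by apply: (neqC _ _ c2 c3 c5) => //; f2_cancel.
  - by apply: (neqC _ _ c2 c3 c4) => //; f2_cancel.
split.
  by rewrite /mdim; have [_ ->] := hyperplane_dim hG0.
exists H0, G0, c4, y; split=> //.
- by rewrite !inE (negPf c4G0) (elts_geom h4) (elts_neq0 h4).
- by rewrite !inE (negPf yH0) yG0 y0.
apply/setP => v; rewrite mem_AGstar // xy.
apply/idP/or3P => [vE|[/and3P[vG vH vy]|/eqP->|/eqP->]] //.
  have [v45|v45] := boolP (v \in [:: c4; c5]).
    by move: v45; rewrite !inE => /orP[]->; [constructor 2 | constructor 3].
  constructor 1; have vyH : v + y \in H0 by rewrite addrC EH0.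
  rewrite mem_adjoin vyH orbT /=; apply/andP; split.
    by apply: contraL vE; apply: EH0'.
  by apply: contraNneq y_E => <-.
move: vG; rewrite mem_adjoin (negPf vH) memH0' addx_eq0 (negPf vy) addrC.
by rewrite -addrA addxx addr0 => /andP[].
Qed.

(** * Periodic sets and doublings *)

Lemma isomorphic_refl N (M : matroid N) : isomorphic M M.
Proof.
exists \1%VF; split=> [x y _ _||]; first by rewrite !id_lfunE.
  by rewrite lim1g.
apply/setP => x; apply/imsetP/idP => [[z zE ->]|xE]; first by rewrite id_lfunE.
by exists x; rewrite ?id_lfunE.
Qed.

Lemma good_restrict N (M : matroid N) (F : {vspace 'rV['F_2]_N}) :
  good (elts M) -> good (elts (restrict M F)).
Proof.
case=> sfE qcE.
have memR v : (v \in elts (restrict M F)) = (v \in elts M) && (v \in F).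
  rewrite !inE; apply: andb_id2l => vE; by rewrite (elts_neq0 vE) andbT.
split=> [a b|a b c d]; rewrite !memR.
  by case/andP=> aE _ /andP[bE _]; rewrite negb_and sfE.
case/andP=> aE aF /andP[bE bF] /andP[cE cF] /andP[dE dF].
by rewrite !rpredD // !andbT; apply: qcE.
Qed.

Lemma pentagon_doublings N (M : matroid N) b1 b2 b3 b4 b5 :
  good (elts M) -> full_rank M -> pentagon (elts M) b1 b2 b3 b4 b5 ->
  obtained_by_doublings M.
Proof.
have [d] := ubnP (mdim M); elim: d M b1 b2 b3 b4 b5 => // d IHd M b1 b2 b3 b4 b5.
rewrite ltnS => dM gM frM pentB.
case: (boolP [exists t, (t != 0) && [forall v in elts M, t + v \in elts M]]); last first.
  rewrite negb_exists => /forallP aperE.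
  have [|n n3 agM] := aperiodic_AGstar gM frM _ pentB; last exact: Doublings_start agM.
  move=> t tE; apply/eqP; have := aperE t; rewrite negb_and negbK => /orP[//|/negP[]].
  by apply/forall_inP.
case/existsP=> w /andP[w0 /forall_inP wE].
have [h1 h2 h3 h4 h5] := pentagon_mem pentB.
have wG : w \in geom M.
  by rewrite -[w](addxKx b1) rpredD ?elts_geom // addrC; apply: wE.
have w_E : w \notin elts M.
  by apply/negP => wM; have := wE _ wM; rewrite addxx (negPf (sumfree0 gM.1)).
have w00 : w \notin (0%VS : {vspace 'rV['F_2]_N}) by rewrite memv0.
have [H [_ wH hH]] := exists_hyperplane (sub0v _) wG w00.
have [HG dG] := hyperplane_dim hH.
have memR v : (v \in elts (restrict M H)) = (v \in elts M) && (v \in H).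
  rewrite !inE; apply: andb_id2l => vE; by rewrite (elts_neq0 vE) andbT.
pose p v := if v \in H then v else w + v.
have pH v : v \in geom M -> p v \in H.
  rewrite /p => vG; case: ifPn => // vH; exact: hyperplane_memD hH wG vG wH vH.
have pE v : v \in elts M -> p v \in elts (restrict M H).
  move=> vE; rewrite memR pH ?elts_geom // andbT /p; case: ifP => // _; exact: wE.
apply: (@Doublings_step _ _ (restrict M H)).
  apply: (IHd _ (p b1) (p b2) (p b3) (p b4) (p b5)).
  - by apply: leq_trans dM; rewrite /mdim dG.
  - exact: good_restrict.
  - rewrite /full_rank; set S := <<_>>%VS.
    have SH : (S <= H)%VS.
      by apply/span_subvP => v; rewrite mem_enum memR => /andP[].
    (* Each [v] in [E] differs from [p v] by 0 or [w], so [S] and [w] span [geom M], which leaves no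
       room for [S] below [H]. *)
    apply/eqP; rewrite eqEdim SH -ltnS -dG /=.
    apply: leq_trans (dimv_add_line_le _ w); apply: dimvS.
    rewrite -[X in (X <= _)%VS]frM; apply/span_subvP => v; rewrite mem_enum => vE.
    have /memv_span : p v \in enum (elts (restrict M H)) by rewrite mem_enum pE.
    rewrite -/S mem_adjoin /p [v + w]addrC; case: ifP => _ ->; by rewrite ?orbT.
  split.
    by move=> x; rewrite !inE => /or4P[/eqP->|/eqP->|/eqP->|/orP[]/eqP->];
       have := pE _ h1; have := pE _ h2; have := pE _ h3; have := pE _ h4;
       have := pE _ h5; rewrite !inE.
  have sumH : p b1 + p b2 + p b3 + p b4 + p b5 \in H by rewrite !rpredD ?pH ?elts_geom.
  (* Each projection adds 0 or [w], so the projected pentagon sums to 0 or [w]; the sum lies in [H],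
     which excludes [w]. *)
  have : p b1 + p b2 + p b3 + p b4 + p b5 \in [:: 0; w].
    have p_step s u v : u \in [:: s; w + s] -> u + p v \in [:: s + v; w + (s + v)].
      rewrite !inE /p => /orP[]/eqP->; case: ifP => _; apply/orP.
      - by left.
      - by right; rewrite addrCA.
      - by right; rewrite addrA.
      - by left; apply/eqP; f2_cancel.
    rewrite -[w]addr0 -pentB.2.
    do 4 apply: (p_step).
    by rewrite /p !inE; case: ifP; rewrite eqxx ?orbT.
  rewrite !inE => /orP[/eqP//|/eqP sw]; by rewrite sw (negPf wH) in sumH.
exists w, H; split=> //.
- by rewrite !inE w_E w0 wG.
- by rewrite inE (negPf wH).
- exact: isomorphic_refl.
apply/setP => v; rewrite in_setU -[elts M :&: points H]/(elts (restrict M H)).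
apply/idP/orP => [vE|[|/imsetP[z + ->]]]; try by rewrite memR => /andP[].
  have [vH|vH] := boolP (v \in H); first by left; rewrite memR vE.
  right; apply/imsetP; exists (w + v); last by rewrite addxKx.
  by have := pE v vE; rewrite /p (negPf vH).
by rewrite memR => /andP[zE _]; apply: wE.
Qed.

(** * Affine sets *)

Section Affine.
Variable N : nat.
Local Notation V := 'rV['F_2]_N.
Implicit Types (x y z a b c d p q : V) (D H T U W : {vspace V}) (B : {set V}) (Q : pred V).

Lemma subv_union U W1 W2 : {in U, forall x, x \in W1 \/ x \in W2} ->
  (U <= W1)%VS \/ (U <= W2)%VS.
Proof.
move=> UW; have [|/subvPn[x xU xW1]] := boolP (U <= W1)%VS; [by left | right].
have xW2 : x \in W2 by case: (UW x xU) => // xW1'; rewrite xW1' in xW1.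
apply/subvP => y yU; have [yW1|//] := UW y yU.
have [xyW1|xyW2] := UW (x + y) (rpredD xU yU); last by rewrite -[y](addxKx x) rpredD.
by case/negP: xW1; rewrite -[x](addxKx y) rpredD // addrC.
Qed.

(** Following the inclusions closes a cycle, whose members coincide and contain any remaining
    space. *)
Lemma maximal_of_three U1 U2 U3 :
    (U1 <= U2)%VS \/ (U1 <= U3)%VS -> (U2 <= U1)%VS \/ (U2 <= U3)%VS ->
    (U3 <= U1)%VS \/ (U3 <= U2)%VS ->
  [\/ (U2 <= U1)%VS /\ (U3 <= U1)%VS, (U1 <= U2)%VS /\ (U3 <= U2)%VS
    | (U1 <= U3)%VS /\ (U2 <= U3)%VS].
Proof.
have tr := @subv_trans _ V.
move=> [h1|h1] [h2|h2] [h3|h3];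
  by [constructor 1; split=> //; eauto | constructor 2; split=> //; eauto
     | constructor 3; split=> //; eauto].
Qed.

(** The second clause places [T] inside [B + B], which lets bounds on [B + B] bound [T]. *)
Lemma stabiliser D B : {subset B <= D} -> B != set0 ->
  exists T, [/\ forall d, d \in T <-> d \in D /\ {in B, forall b, b + d \in B},
    {in T, forall d, exists2 x, x \in B & x + d \in B} & (D <= T)%VS -> {subset D <= B}].
Proof.
move=> BD /set0Pn[b0 b0B].
have [T memT] : exists T, T =i [set d in D | [forall b in B, b + d \in B]].
  apply: closed_vspace => [|d e]; rewrite !inE.
    by rewrite mem0v; apply/forall_inP => b; rewrite addr0.
  case/andP=> dD /forall_inP dB /andP[eD /forall_inP eB]; rewrite rpredD //=.
  by apply/forall_inP => b bB; rewrite addrA eB // dB.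
have TP d : d \in T <-> d \in D /\ {in B, forall b, b + d \in B}.
  by rewrite memT inE; split=> [/andP[-> /forall_inP]|[-> /forall_inP]].
exists T; split=> // [d /TP[_ dB]|/subvP DT x xD]; first by exists b0; rewrite ?dB.
have /TP[_ sB] : b0 + x \in T by rewrite DT // rpredD // BD.
by rewrite -[x](addxKx b0) sB.
Qed.

(** If the largest stabiliser [T1] is [D], then [B1] is [D], so [D] is covered by [T2] and [T3] and
    one of them is [D] as well. Otherwise [T1] is proper and contains all the pair sums. *)
Lemma three_sets_top D B1 B2 B3 T1 T2 T3 :
    (T1 <= D)%VS -> ((D <= T1)%VS -> {subset D <= B1}) -> ((D <= T2)%VS -> {subset D <= B2}) ->
    ((D <= T3)%VS -> {subset D <= B3}) ->
    {in B1 &, forall x y, x + y \in T2 \/ x + y \in T3} ->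
    {in B2 &, forall x y, x + y \in T1 \/ x + y \in T3} ->
    {in B3 &, forall x y, x + y \in T1 \/ x + y \in T2} ->
    (T2 <= T1)%VS -> (T3 <= T1)%VS ->
  [\/ {subset D <= B1} /\ {subset D <= B2}, {subset D <= B1} /\ {subset D <= B3}
    | exists2 T, (T <= D)%VS /\ T != D &
      [/\ {in B1 &, forall x y, x + y \in T}, {in B2 &, forall x y, x + y \in T}
        & {in B3 &, forall x y, x + y \in T}]].
Proof.
move=> T1D f1 f2 f3 p1 p2 p3 T21 T31.
have [DT1|DT1] := boolP (D <= T1)%VS.
  have DB1 := f1 DT1; have [|DT2|DT3] := @subv_union D T2 T3.
  - by move=> x xD; rewrite -[x]addr0; apply: p1; apply: DB1; rewrite ?mem0v.
  - by constructor 1; split=> //; apply: f2.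
  - by constructor 2; split=> //; apply: f3.
constructor 3; exists T1.
  by split=> //; apply: contraNneq DT1 => ->.
have T1s W x : x \in W -> (W <= T1)%VS -> x \in T1 by move=> xW /subvP; apply.
by split=> x y xB yB;
  [case: (p1 x y xB yB) | case: (p2 x y xB yB) | case: (p3 x y xB yB)] => /T1s; apply.
Qed.

(* The stabilisers T_i of the B_i in D satisfy B_i + B_i <= T_j u T_k, so the
   largest of them contains all the B_i + B_i. *)
Lemma three_sets D B1 B2 B3 :
    {subset B1 <= D} -> {subset B2 <= D} -> {subset B3 <= D} ->
    B1 != set0 -> B2 != set0 -> B3 != set0 ->
    (forall x y b c, x \in B1 -> y \in B1 -> b \in B2 -> c \in B3 ->
       b + (x + y) \in B2 \/ c + (x + y) \in B3) ->
    (forall x y b c, x \in B2 -> y \in B2 -> b \in B1 -> c \in B3 ->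
       b + (x + y) \in B1 \/ c + (x + y) \in B3) ->
    (forall x y b c, x \in B3 -> y \in B3 -> b \in B1 -> c \in B2 ->
       b + (x + y) \in B1 \/ c + (x + y) \in B2) ->
  [\/ {subset D <= B1} /\ {subset D <= B2}, {subset D <= B1} /\ {subset D <= B3},
      {subset D <= B2} /\ {subset D <= B3}
    | exists2 T, (T <= D)%VS /\ T != D &
      [/\ {in B1 &, forall x y, x + y \in T}, {in B2 &, forall x y, x + y \in T}
        & {in B3 &, forall x y, x + y \in T}]].
Proof.
move=> B1D B2D B3D n1 n2 n3 h1 h2 h3.
have [T1 [t1 s1 f1]] := stabiliser B1D n1.
have [T2 [t2 s2 f2]] := stabiliser B2D n2.
have [T3 [t3 s3 f3]] := stabiliser B3D n3.
(* A single [b] with [b + d] outside [B] forces [c + d] into [C] for every [c]. *)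
have stab_or (B C : {set V}) (S T : {vspace V}) (d : V) :
    (forall e, e \in S <-> e \in D /\ {in B, forall b, b + e \in B}) ->
    (forall e, e \in T <-> e \in D /\ {in C, forall b, b + e \in C}) -> d \in D ->
    (forall b c, b \in B -> c \in C -> b + d \in B \/ c + d \in C) -> d \in S \/ d \in T.
  move=> SP TP dD BC; have [/forall_inP dB|] := boolP [forall b in B, b + d \in B].
    by left; apply/SP.
  rewrite negb_forall_in => /exists_inP[b bB bdB]; right; apply/TP; split=> // c cC.
  by case: (BC b c bB cC) => // bdB'; rewrite bdB' in bdB.
have p1 : {in B1 &, forall x y, x + y \in T2 \/ x + y \in T3}.
  move=> x y xB yB; apply: (stab_or B2 B3 _ _ _ t2 t3) => [|b c bB cB]; last exact: h1.
  by apply: rpredD; apply: B1D.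
have p2 : {in B2 &, forall x y, x + y \in T1 \/ x + y \in T3}.
  move=> x y xB yB; apply: (stab_or B1 B3 _ _ _ t1 t3) => [|b c bB cB]; last exact: h2.
  by apply: rpredD; apply: B2D.
have p3 : {in B3 &, forall x y, x + y \in T1 \/ x + y \in T2}.
  move=> x y xB yB; apply: (stab_or B1 B2 _ _ _ t1 t2) => [|b c bB cB]; last exact: h3.
  by apply: rpredD; apply: B3D.
(* [T] lies in [B + B], hence in the union of [W] and [W'], and no space is the union of two proper
   subspaces. *)
have TB (B : {set V}) (T W W' : {vspace V}) : {in T, forall d, exists2 x, x \in B & x + d \in B} ->
    {in B &, forall x y, x + y \in W \/ x + y \in W'} -> (T <= W)%VS \/ (T <= W')%VS.
  move=> sT pB; apply: subv_union => d /sT[x xB xdB].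
  by rewrite -[d](addxKx x); apply: pB.
have [T1D T2D T3D] : [/\ (T1 <= D)%VS, (T2 <= D)%VS & (T3 <= D)%VS].
  by split; apply/subvP => d; [case/t1 | case/t2 | case/t3].
have swap B T T' : {in B &, forall x y, x + y \in T \/ x + y \in T'} ->
    {in B &, forall x y, x + y \in T' \/ x + y \in T}.
  by move=> pB x y xB yB; case: (pB x y xB yB); [right | left].
have [[T21 T31]|[T12 T32]|[T13 T23]] :=
  maximal_of_three (TB _ _ _ _ s1 p1) (TB _ _ _ _ s2 p2) (TB _ _ _ _ s3 p3).
- have [] := three_sets_top T1D f1 f2 f3 p1 p2 p3 T21 T31;
    [by constructor 1 | by constructor 2 | by constructor 4].
- have [[? ?]||[T TDD [? ? ?]]] :=
    three_sets_top T2D f2 f1 f3 p2 p1 (swap _ _ _ p3) T12 T32.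
  + by constructor 1.
  + by constructor 3.
  + by constructor 4; exists T.
- have [[? ?]|[? ?]|[T TDD [? ? ?]]] :=
    three_sets_top T3D f3 f1 f2 p3 (swap _ _ _ p1) (swap _ _ _ p2) T13 T23.
  + by constructor 2.
  + by constructor 3.
  + by constructor 4; exists T.
Qed.

End Affine.

(* [balanced H p Q]: within the affine space [p + H] no 3-dimensional flat meets
   [Q] in exactly four affinely independent points. *)
Definition balanced N (H : {vspace 'rV['F_2]_N}) (p : 'rV['F_2]_N) (Q : pred 'rV['F_2]_N) :=
  forall a b c d, a + p \in H -> b + p \in H -> c + p \in H -> d + p \in H ->
    Q a -> Q b -> Q c -> Q d ->
    [|| Q (a + b + c), Q (a + b + d), Q (a + c + d) | Q (b + c + d)].

Definition monochromatic N (D : {vspace 'rV['F_2]_N}) (p : 'rV['F_2]_N)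
    (Q : pred 'rV['F_2]_N) :=
  (forall x, x + p \in D -> Q x) \/ (forall x, x + p \in D -> ~~ Q x).

(** * Monochromatic translates of hyperplanes *)

Section Balanced.
Variable N : nat.
Local Notation V := 'rV['F_2]_N.
Implicit Types (x y z a b c d p q : V) (D H K : {vspace V}) (Q : pred V).

Lemma balanced_coset H p q Q : q + p \in H -> balanced H p Q -> balanced H q Q.
Proof.
move=> qp bQ a b c d aH bH cH dH; apply: bQ;
by rewrite -[p](addxKx q) addrA rpredD.
Qed.

Lemma balanced_sub H K p Q : (K <= H)%VS -> balanced H p Q -> balanced K p Q.
Proof. by move=> /subvP KH bQ a b c d aK bK cK dK; apply: bQ; apply: KH. Qed.

Lemma sum3_coset H p a b c : a + p \in H -> b + p \in H -> c + p \in H ->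
  a + b + c + p \in H.
Proof.
move=> aH bH cH; rewrite (_ : _ + p = (a + p) + (b + p) + (c + p)); last by f2_cancel.
by apply: rpredD => //; apply: rpredD.
Qed.

(* If a, b, c, d lie outside [Q] and their triple sums lie in [Q], then the
   triple sums of the latter are a, b, c, d. *)
Lemma balanced_predC H p Q : balanced H p Q -> balanced H p (predC Q).
Proof.
move=> bQ a b c d aH bH cH dH /= nQa nQb nQc nQd; rewrite -!negb_and.
apply/negP => /and4P[Qabc Qabd Qacd Qbcd].
have := bQ (a + b + c) (a + b + d) (a + c + d) (b + c + d).
rewrite (_ : (a + b + c) + (a + b + d) + (a + c + d) = a); last by f2_cancel.
rewrite (_ : (a + b + c) + (a + b + d) + (b + c + d) = b); last by f2_cancel.
rewrite (_ : (a + b + c) + (a + c + d) + (b + c + d) = c); last by f2_cancel.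
rewrite (_ : (a + b + d) + (a + c + d) + (b + c + d) = d); last by f2_cancel.
rewrite (negPf nQa) (negPf nQb) (negPf nQc) (negPf nQd).
by move=> abcd; suff: false by []; apply: abcd; rewrite ?sum3_coset.
Qed.

Lemma monochromatic_predC D p Q : monochromatic D p (predC Q) -> monochromatic D p Q.
Proof. by case=> mQ; [right | left] => x xD; have := mQ x xD; rewrite /= ?negbK. Qed.

Lemma white_extend D H p Q : (D <= H)%VS -> \dim H = (\dim D).+2 -> balanced H p Q ->
  (forall x, x + p \in D -> ~~ Q x) ->
  exists D1 q, [/\ hyperplane D1 H, q + p \in H & monochromatic D1 q Q].
Proof.
move=> DH dH bQ wD.
have hyp_adj (t : V) : t \in H -> t \notin D -> hyperplane (D + <[t]>) H.
  move=> tH tD; apply: dim_hyperplane; first by rewrite subv_add DH -memvE.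
  by rewrite dimv_add_line.
have [a aH aD] : exists2 a, a \in H & a \notin D.
  apply: notin_vspace => //; apply/eqP => eH; move: dH.
  by rewrite -eH => /eqP; rewrite ltn_eqF.
have [b bH baD] : exists2 b, b \in H & b \notin (D + <[a]>)%VS.
  have [h1 _] := hyperplane_dim (hyp_adj a aH aD).
  apply: notin_vspace => //; apply/eqP => eH; move: dH.
  by rewrite -eH dimv_add_line // => /eqP; rewrite ltn_eqF.
have [bD abD] : b \notin D /\ a + b \notin D.
  by move: baD; rewrite mem_adjoin negb_or addrC => /andP[].
have defH x : x \in H -> [\/ x \in D, x + a \in D, x + b \in D | x + (a + b) \in D].
  move=> xH; have : x \in (D + <[a]> + <[b]>)%VS.
    by rewrite -(hyperplane_adjoin (hyp_adj a aH aD) bH baD).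
  rewrite !mem_adjoin -orbA -addrA [b + a]addrC.
  by case/or4P=> ?; [constructor 1 | constructor 2 | constructor 3 | constructor 4].
have pH : p + p \in H by rewrite addxx mem0v.
(* [B t] is the trace of [Q] on the coset [p + t + D], translated into [D]. An empty trace joins the
   white coset [p + D] to form a white translate of a hyperplane; two full traces form a black
   one. *)
pose B t := [set d in D | Q (p + t + d)].
have memB t d : (d \in B t) = (d \in D) && Q (p + t + d) by rewrite inE.
have BD t : {subset B t <= D} by move=> d; rewrite memB => /andP[].
have white t : t \in H -> t \notin D -> B t = set0 ->
    exists D1 q, [/\ hyperplane D1 H, q + p \in H & monochromatic D1 q Q].
  move=> tH tD B0; exists (D + <[t]>)%VS, p; split=> //; first exact: hyp_adj.
  right=> x; rewrite mem_adjoin => /orP[/wD//|xD]; apply/negP => Qx.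
  have : x + p + t \in B t by rewrite memB xD /= (_ : _ + _ = x) //; f2_cancel.
  by rewrite B0 inE.
have [Ba0|Ba0] := eqVneq (B a) set0; first exact: white Ba0.
have [Bb0|Bb0] := eqVneq (B b) set0; first exact: white Bb0.
have [Bab0|Bab0] := eqVneq (B (a + b)) set0; first by apply: white Bab0 => //; apply: rpredD.
have black s t : s \in H -> t \in H -> s + t \notin D ->
    {subset D <= B s} -> {subset D <= B t} ->
    exists D1 q, [/\ hyperplane D1 H, q + p \in H & monochromatic D1 q Q].
  move=> sH tH stD Bs Bt; exists (D + <[s + t]>)%VS, (p + s); split.
  - by apply: hyp_adj => //; apply: rpredD.
  - by rewrite addrAC addxx add0r.
  have Qx r x : x + (p + r) \in B r -> Q x.
    by rewrite memB (_ : p + r + _ = x); [case/andP | f2_cancel].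
  left=> x; rewrite mem_adjoin => /orP[/Bs/Qx//|].
  rewrite (_ : x + (p + s) + (s + t) = x + (p + t)); last by f2_cancel.
  by move/Bt/Qx.
have DHm (d : V) : d \in D -> d \in H by apply: (subvP DH).
(* Take two points on the coset of [s] and one on each of those of [t] and [s + t]. The two triple
   sums with one point on each coset fall in the white coset, so one of the other two satisfies
   [Q]. *)
have key s t x y u v : s \in H -> t \in H -> x \in B s -> y \in B s -> u \in B t ->
    v \in B (s + t) -> u + (x + y) \in B t \/ v + (x + y) \in B (s + t).
  move=> sH tH; rewrite !memB => /andP[xD Qx] /andP[yD Qy] /andP[uD Qu] /andP[vD Qv].
  have cos r d : r \in H -> d \in D -> p + r + d + p \in H.
    move=> rH dD; rewrite (_ : _ + p = r + d); last by f2_cancel.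
    by rewrite rpredD // DHm.
  have := bQ _ _ _ _ (cos _ _ sH xD) (cos _ _ sH yD) (cos _ _ tH uD) 
    (cos _ _ (rpredD sH tH) vD) Qx Qy Qu Qv.
  rewrite (_ : _ + (p + s + y) + (p + t + u) = p + t + (u + (x + y))); last by f2_cancel.
  rewrite (_ : _ + (p + s + y) + (p + (s + t) + v) = p + (s + t) + (v + (x + y))); last by f2_cancel.
  have w d : d \in D -> Q (p + d) = false.
    by move=> dD; apply/negbTE/wD; rewrite addrAC addxx add0r.
  rewrite (_ : (p + s + x) + (p + t + u) + (p + (s + t) + v) = p + (x + u + v)); last by f2_cancel.
  rewrite (_ : (p + s + y) + (p + t + u) + (p + (s + t) + v) = p + (y + u + v)); last by f2_cancel.
  rewrite !w ?rpredD // !orbF.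
  by case/orP=> ->; [left | right]; rewrite andbT.
have abH := rpredD aH bH.
have := three_sets (BD a) (BD b) (BD (a + b)) Ba0 Bb0 Bab0.
case.
- by move=> x y u v; apply: key.
- by move=> x y u v xB yB uB; have := key b a x y u v bH aH xB yB uB; rewrite [b + a]addrC.
- move=> x y u v xB yB uB vB; have := key (a + b) a x y u v abH aH xB yB uB.
  by rewrite addrAC addxx add0r; apply.
- by case=> Da Db; apply: black Da Db.
- by case=> Da Dab; apply: black Da Dab => //; rewrite addxKx.
- by case=> Db Dab; apply: black Db Dab => //; rewrite addrCA addxx addr0.
case=> T [TD TneD] [Ta Tb Tab].
have [[da daB] [db dbB] [dab dabB]] := And3 (set0Pn _ Ba0) (set0Pn _ Bb0) (set0Pn _ Bab0).
pose xa := p + a + da; pose xb := p + b + db; pose xab := p + (a + b) + dab.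
(* Every point of [Q] on [p + H] lies in [xa + K]. As [T] is proper in [D], [K] is proper in [H],
   and the coset off [xa] of a hyperplane containing [K] is white. *)
pose K := (T + <[xa + xb]> + <[xa + xab]>)%VS.
have daH : da \in H := DHm _ (BD _ _ daB).
have xbaH : xa + xb \in H.
  rewrite (_ : xa + xb = a + b + (da + db)); last by rewrite /xa /xb; f2_cancel.
  by apply: rpredD => //; apply: rpredD; apply: DHm; [apply: BD daB | apply: BD dbB].
have xabaH : xa + xab \in H.
  rewrite (_ : xa + xab = b + (da + dab)); last by rewrite /xa /xab; f2_cancel.
  by apply: rpredD => //; apply: rpredD; apply: DHm; [apply: BD daB | apply: BD dabB].
have KH : (K <= H)%VS by rewrite !subv_add -!memvE xbaH xabaH (subv_trans TD DH).
have [z zH zK] : exists2 z, z \in H & z \notin K.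
  apply: notin_vspace => //; apply/eqP => eK.
  have dK : (\dim K <= (\dim T).+2)%N.
    by apply: leq_trans (dimv_add_line_le _ _) _; rewrite ltnS dimv_add_line_le.
  by move: dK (proper_dimv TD TneD); rewrite eK dH !ltnS leqNgt => /negP.
have [K' [/subvP KK' zK' hK']] := exists_hyperplane KH zH zK.
have TK' u : u \in T -> u \in K'.
  by move=> uT; apply: KK'; rewrite mem_adjoin [u \in _]mem_adjoin uT.
have xbK' : xa + xb \in K'.
  by apply: KK'; rewrite mem_adjoin [xa + xb \in _]mem_adjoin addxx mem0v orbT.
have xabK' : xa + xab \in K' by apply: KK'; rewrite mem_adjoin addxx mem0v orbT.
have [/subvP K'H _] := hyperplane_dim hK'.
exists K', (xa + z); split=> //.
  rewrite (_ : _ + p = a + da + z); last by rewrite /xa; f2_cancel.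
  by rewrite !rpredD.
right=> x xK'; apply/negP => Qx.
have xxaK' : x + xa \notin K'.
  apply: contra zK' => xxa; rewrite -[z](addxKx (x + xa)) rpredD //.
  by rewrite addrA in xK'.
have xpH : x + p \in H.
  rewrite (_ : x + p = x + (xa + z) + (a + da + z)); last by rewrite /xa; f2_cancel.
  by apply: rpredD; [apply: K'H | rewrite !rpredD].
case/negP: xxaK'; have Qd t : x + p + t \in D -> x + p + t \in B t.
  by move=> xD; rewrite memB xD (_ : p + t + _ = x) //; f2_cancel.
have [xD|/Qd xD|/Qd xD|/Qd xD] := defH _ xpH.
- by have := wD x xD; rewrite Qx.
- by rewrite (_ : x + xa = x + p + a + da) ?TK' ?Ta // /xa; f2_cancel.
- rewrite (_ : x + xa = (x + p + b + db) + (xa + xb)); last by rewrite /xb; f2_cancel.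
  by rewrite rpredD // TK' // Tb.
rewrite (_ : x + xa = (x + p + (a + b) + dab) + (xa + xab)); last by rewrite /xab; f2_cancel.
by rewrite rpredD // TK' // Tab.
Qed.

Lemma monochromatic_hyperplane H p Q : (0 < \dim H)%N -> balanced H p Q ->
  exists D q, [/\ hyperplane D H, q + p \in H & monochromatic D q Q].
Proof.
have [n] := ubnP (\dim H); elim: n H p => // n IHn H p; rewrite ltnS => dHn dH0 bQ.
have [x xH x0] : exists2 x, x \in H & x \notin (0%VS : {vspace V}).
  apply: notin_vspace; rewrite ?sub0v //.
  by apply: contraTneq dH0 => <-; rewrite dimv0.
have [H' [_ _ hH']] := exists_hyperplane (sub0v _) xH x0.
have [H'H dH] := hyperplane_dim hH'.
have [dH'0|dH'0] := posnP (\dim H').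
  (* A coset of the zero space is a single point, hence monochromatic. *)
  exists H', p; split=> //; first by rewrite addxx mem0v.
  have H'0 y : y + p \in H' -> y = p.
    move: dH'0 => /eqP; rewrite dimv_eq0 => /eqP->.
    by rewrite memv0 addx_eq0 => /eqP.
  by have [Qp|Qp] := boolP (Q p); [left | right] => y /H'0->.
have [|D [q [hD qpH' mQ]]] := IHn H' p _ dH'0 (balanced_sub H'H bQ).
  by rewrite -ltnS -dH.
have [DH' dD] := hyperplane_dim hD.
have qpH : q + p \in H by apply: (subvP H'H).
have bqQ := balanced_coset qpH bQ.
have dHD : \dim H = (\dim D).+2 by rewrite dH dD.
have DH := subv_trans DH' H'H.
have shift q' : q' + q \in H -> q' + p \in H.
  by move=> q'H; rewrite -[p](addxKx q) addrA rpredD.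
(* A black translate is white for the complement of [Q], which is balanced too. *)
case: mQ => mQ; last first.
  by have [D1 [q1 [? ? ?]]] := white_extend DH dHD bqQ mQ; exists D1, q1; split; auto.
have [|D1 [q1 [? ? ?]]] := white_extend DH dHD (balanced_predC bqQ).
  by move=> y /mQ; rewrite /= negbK.
by exists D1, q1; split; auto; apply: monochromatic_predC.
Qed.

End Balanced.

Lemma affine_expansions N (M : matroid N) :
  good (elts M) -> affine M -> obtained_by_expansions M.
Proof.
have [n] := ubnP (mdim M); elim: n M => // n IHn M; rewrite ltnS => dM gM [H [hH EH]].
have [HG dG] := hyperplane_dim hH.
have [dH0|dH0] := posnP (\dim H); first by apply: Expansions_start; rewrite /mdim dG dH0.
have E_H v : v \in elts M -> v \notin H.
  move=> vE; have := subsetP EH v vE; rewrite !inE => /andP[vH _].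
  by rewrite (elts_neq0 vE) andbT in vH.
have [_ HneG _] := hH; have [p pG pH] := notin_vspace HG HneG.
(* A sum of four elements off [H] lies in [H], so only the triple sums can be in [E]. *)
have bE : balanced H p (fun v => v \in elts M).
  move=> a b c d aH bH cH dH aE bE cE dE.
  have /or4P[->|->|->|/orP[->|/E_H/negP[]]] := gM.2 a b c d aE bE cE dE; rewrite ?orbT //.
  rewrite (_ : a + b + c + d = (a + p) + (b + p) + ((c + p) + (d + p))); last by f2_cancel.
  by apply: rpredD; apply: rpredD.
have [D [q [hD qpH mE]]] := monochromatic_hyperplane dH0 bE.
have [DH dD] := hyperplane_dim hD.
have qG : q \in geom M by rewrite -[q](addxKx p) rpredD // addrC (subvP HG).
have qH : q \notin H by apply: contra pH => qH; rewrite -[p](addxKx q) rpredD.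
have [_ DneH _] := hD; have [z zH zD] := notin_vspace DH DneH.
have zqH : z + q \notin H by rewrite (rpredDl _ zH).
have zqD : z + q \notin D by apply: contra zqH; apply: (subvP DH).
(* The complement of [H] splits into [q + D] and [q + z + D]. [G0] contains the second half and
   misses the first, so a black [q + D] gives a 1-expansion of the restriction to [G0] and a white
   one a 0-expansion. *)
pose G0 := (D + <[z + q]>)%VS.
have hG0 : hyperplane G0 (geom M).
  apply: dim_hyperplane; last by rewrite dG dD dimv_add_line.
  by rewrite subv_add (subv_trans DH HG) -memvE rpredD // (subvP HG).
have qG0 : q \notin G0.
  rewrite mem_adjoin negb_or; apply/andP; split.
    by apply: contra qH; apply: (subvP DH).
  by rewrite addrCA addxx addr0.
have split_E v : v \in elts M -> v + q \in D \/ v \in G0.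
  move=> vE; have vqH : v + q \in H.
    by apply: (hyperplane_memD hH) => //; [apply: elts_geom | apply: E_H].
  move: vqH; rewrite (hyperplane_adjoin hD zH zD) mem_adjoin => /orP[]; first by left.
  by move=> vqz; right; rewrite mem_adjoin [z + q]addrC addrA vqz orbT.
have aff : affine_wrt (restrict M G0) D.
  split; first exact: adjoin_hyperplane.
  apply/subsetP => v; rewrite !inE => /and3P[vE vG0 v0]; rewrite vG0 v0 !andbT.
  by apply: contra (E_H v vE); apply: (subvP DH).
have obt : obtained_by_expansions (restrict M G0).
  apply: IHn; [|exact: good_restrict|by exists D].
  by apply: leq_trans dM; rewrite /mdim; have [_ ->] := hyperplane_dim hG0.
case: mE => mE.
  apply: Expansions_1 obt _; exists D; split=> //; exists q.
    by rewrite !inE (negPf qG0) qG; apply: contraNneq qH => ->; apply: mem0v.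
  apply/setP => v; rewrite -setUA in_setU mem_translate !inE.
  apply/idP/orP => [vE|[/andP[]|/mE]] //.
  by case: (split_E v vE) => [|vG0]; [right | left; rewrite vE vG0 (elts_neq0 vE)].
apply: Expansions_0 obt _; split=> //; first by exists D.
apply/setP => v; rewrite !inE; apply/idP/andP => [vE|[]//].
rewrite vE (elts_neq0 vE) andbT; split=> //.
by case: (split_E v vE) => [/mE/negP[]|].
Qed.

Local Close Scope ring_scope.

Theorem theorem1p1 (N : nat) (M : matroid N) (hdim : 1 <= mdim M)
    (hfull : full_rank M) :
  (I4_free M /\ triangle_free M) <->
  (obtained_by_expansions M \/ obtained_by_doublings M).
Proof.
rewrite -goodP; split=> [gM|[/good_expansions|/good_doublings] //].
have E0 : elts M != set0.
  apply: contraTneq hdim => E0; rewrite /mdim -hfull E0 (_ : <<_>>%VS = 0%VS) ?dimv0 //.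
  by rewrite enum_set0 span_nil.
have [aM|[c1 [c2 [c3 [c4 [c5 pentC]]]]]] := affine_or_pentagon gM E0.
  by left; apply: affine_expansions.
by right; apply: pentagon_doublings pentC.
Qed.
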